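(* Let $I\subset\mathbb{R}$ be an interval and let $\{\varphi_u,u\in I\}$ be a kernel satisfying $$\sup_{u\in I}\|\varphi_u\|_1<\infty.$$ Then for every $\sigma>0$ and every uniformly discrete set $\Lambda\subset\mathbb{R}$ there is a constant $B$ such that $$\int_I\sum_{\lambda\in\Lambda}|(f\ast\varphi_u)(\lambda)|^2\,du\le B\|f\|_2^2\quad\text{for all } f\in PW_\sigma.$$
   Context: The Fourier transform is $\hat f(t)=\int_{\mathbb{R}}e^{-itx}f(x)\,dx$. For $\sigma>0$, the Paley--Wiener space is $PW_\sigma=\{f\in L^2(\mathbb{R}):\operatorname{supp}\hat f\subseteq[-\sigma,\sigma]\}$; its elements are identified with their continuous representatives. $\|\cdot\|_p$ is the norm of $L^p(\mathbb{R})$, and $(f\ast\varphi)(x)=\int_{\mathbb{R}}\varphi(x-s)f(s)\,ds$. A set $\Lambda\subset\mathbb{R}$ is uniformly discrete if $\inf_{\lambda,\lambda'\in\Lambda,\lambda\neq\lambda'}|\lambda-\lambda'|>0$. A kernel is a family $\{\varphi_u,u\in I\}$ of functions on $\mathbb{R}$; $\Phi_u$ denotes the Fourier transform of $\varphi_u$. It is assumed throughout that $\varphi_u(x)$ and $\Phi_u(t)$ are continuous functions of $(x,u)$ and $(t,u)$, respectively.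
   Formalization: The interval I is assumed bounded; for every unbounded I the claim fails, e.g. for φ_u equal to one fixed Gaussian, Λ={0} and f in PW_σ with (f∗φ)(0)≠0, where the left side is infinite. *)

(* Defs.v *)
(* MathComp-Analysis, over an abstract [R : realType]; complex numbers are [R[i]]. *)
From HB Require Import structures.
From mathcomp Require Export all_boot all_order all_algebra.
From mathcomp Require Export all_classical all_reals all_analysis.
From mathcomp Require Export complex.

Set Implicit Arguments.
Unset Strict Implicit.
Unset Printing Implicit Defensive.

Import Order.TTheory GRing.Theory Num.Theory.
Import numFieldNormedType.Exports.

Local Open Scope classical_set_scope.
Local Open Scope ring_scope.
Local Open Scope complex_scope.

Section Definitions.
Context {R : realType}.
Implicit Types (f g phi : R -> R[i]) (D S : set R) (z : R[i]).

Local Notation mu := (@lebesgue_measure R).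

(* The norm `|z| of the library is itself an element of R[i]; this is the same
   modulus as an element of R. *)
Definition cabs z : R := ComplexField.Normc.normc z.

(* The library's integral is for real-valued functions. *)
Definition cintegral f : R[i] :=
  (\int[mu]_x complex.Re (f x))%R +i* (\int[mu]_x complex.Im (f x))%R.

Definition cmeasurable f : Prop :=
  measurable_fun setT (fun x => complex.Re (f x)) /\
  measurable_fun setT (fun x => complex.Im (f x)).

Definition cLnorm (p : \bar R) f : \bar R :=
  ('N[mu]_p[EFin \o (fun x => cabs (f x))])%E.

Definition L2 f : Prop := cmeasurable f /\ (cLnorm 2%:E f < +oo)%E.

Definition expi (t : R) : R[i] := cos t +i* sin t.

Definition fourier f (t : R) : R[i] := cintegral (fun x => expi (- (t * x)) * f x).

(* The integral [fourier f] need not converge for f in L^2, and then the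
   Fourier transform is the one given by Plancherel's theorem: g is the L^2-limit
   of the transforms of the truncations of f to [-n, n].  It is determined up to
   a null set, hence a relation. *)
Definition is_fourier_L2 f g : Prop :=
  [/\ L2 f, L2 g &
   (fun n : nat => cLnorm 2%:E
      (fourier (fun x => if x \in `[- n%:R, n%:R] then f x else 0) \- g)) @ \oo --> 0%E].

(* Support of an almost-everywhere class: the complement of the largest open
   set on which g vanishes almost everywhere. *)
Definition ae_support g : set R :=
  [set t | ~ exists2 U, nbhs t U & \forall x \ae mu, U x -> g x = 0].

(* R[i] carries its norm topology through the alias R[i]^o. *)
Definition PW (sigma : R) : set (R -> R[i]) :=
  [set f | continuous (f : R -> R[i]^o) /\
     exists2 g, is_fourier_L2 f g & ae_support g `<=` `[- sigma, sigma]].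

Definition convolution f phi (x : R) : R[i] :=
  cintegral (fun s => phi (x - s) * f s).

(* The infimum is taken in \bar R, so that it is +oo when S has at most one
   point. *)
Definition uniformly_discrete S : Prop :=
  (0 < ereal_inf
    [set d : \bar R | exists x y : R, [/\ S x, S y, x != y & d = (`|x - y|)%:E]])%E.

(* The values of [phi u] for u outside I play no role. *)
Definition continuous_kernel (I : set R) (phi : R -> R -> R[i]) : Prop :=
  {within setT `*` I, continuous ((fun xu => phi xu.2 xu.1) : R * R -> R[i]^o)} /\
  {within setT `*` I,
    continuous ((fun tu => fourier (phi tu.2) tu.1) : R * R -> R[i]^o)}.

End Definitions.

(* Main.v *)
Require Import Defs.
From HB Require Import structures.
From mathcomp Require Import all_boot all_order all_algebra.
From mathcomp Require Import all_classical all_reals all_analysis.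
From mathcomp Require Import complex.
From mathcomp Require Import measurable_realfun ring lra.

Set Implicit Arguments.
Unset Strict Implicit.
Unset Printing Implicit Defensive.

Import Order.TTheory GRing.Theory Num.Theory.
Import numFieldNormedType.Exports.

Local Open Scope classical_set_scope.
Local Open Scope ring_scope.
Local Open Scope complex_scope.

(* Proof. Let V be the de la Vallee-Poussin kernel of parameter a, i.e. the
   inverse transform (up to a factor) of a trapezoid equal to 1 on [-a, a].  For
   f in PW_sigma, testing the truncated transforms of f against a trapezoid
   modulated by e^(itx) and using Fubini shows that the convolution of f with V
   does not depend on a >= sigma, because the difference of two such trapezoids
   vanishes on [-sigma, sigma].  As a tends to infinity the convolution tends to
   c f(x), the Fejer kernels being an approximate identity of mass c > 0.  Hence
   c f is the convolution of f with the kernel of parameter sigma, which is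
   O(1 / (1 + z^2)), and Cauchy-Schwarz gives
     |f(x)|^2 <= A \int |f(y)|^2 / (1 + (x - y)^2) dy.
   Summing over a d-separated set translated by any s yields
   \sum_l |f(l - s)|^2 <= B ||f||^2 uniformly in s.  Finally, Cauchy-Schwarz
   with weight |phi_u| bounds |(f * phi_u)(l)|^2 by
   2 ||phi_u||_1 \int |phi_u(s)| |f(l - s)|^2 ds; one sums over l and integrates
   over the bounded interval I. *)

(** * Changes of variable, Cauchy-Schwarz and domination for the Lebesgue integral on the line *)

Section LebesgueIntegral.
Context {R : realType}.
Local Notation mu := (@lebesgue_measure R).
Local Notation rT := (measurableTypeR R).

(** The image of Lebesgue measure under [y |-> x - y] gives half-open intervals their length, since
    the preimage of []a, b]] is [[x - b, x - a[]; uniqueness of Lebesgue measure concludes. *)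
Lemma ge0_integral_reflect (f : R -> \bar R) (x : R) :
  measurable_fun [set: R] f -> (forall y, 0 <= f y)%E ->
  (\int[mu]_y f (x - y)%R = \int[mu]_y f y)%E.
Proof.
move=> mf f0.
pose h (y : measurableTypeR R) : measurableTypeR R := x - y.
have mh : measurable_fun [set: measurableTypeR R] h by apply: measurable_funB.
rewrite -[LHS](ge0_integral_pushforward mh mu (D := setT) (f := f))//.
apply: eq_measure_integral => A mA _; apply/esym/lebesgue_measure_unique => //.
move=> _ [[a b]] _ <- /=; rewrite /pushforward.
have -> : h @^-1` `]a, b]%classic = `[x - b, x - a[%classic.
  by apply/seteqP; split=> y; rewrite /= !in_itv/= /h => /andP[? ?];
    apply/andP; split; lra.
rewrite !lebesgue_measure_itv/= !lte_fin.
by rewrite ltrD2l ltrN2; case: ifP => // _; rewrite -!EFinD; congr (_%:E); ring.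
Qed.

(** Same uniqueness argument: the image measure under [y |-> a * y] shrinks lengths by [a], and the
    factor [a] restores them. *)
Lemma ge0_integral_dilate (f : R -> \bar R) (a : R) : 0 < a ->
  measurable_fun [set: R] f -> (forall y, 0 <= f y)%E ->
  (\int[mu]_y (a%:E * f (a * y)%R) = \int[mu]_y f y)%E.
Proof.
move=> a0 mf f0.
pose h (y : measurableTypeR R) : measurableTypeR R := a * y.
have mh : measurable_fun [set: measurableTypeR R] h by apply: measurable_funM.
rewrite ge0_integralZl_EFin//; last 2 first.
  exact: (measurableT_comp mf mh).
  exact: ltW.
rewrite -(ge0_integral_pushforward mh mu (D := setT) (f := f))//.
rewrite -(@ge0_integral_mscale _ _ _ (pushforward mu h)
  setT _ (NngNum (ltW a0)))//.
apply: eq_measure_integral => A mA _; apply/esym/lebesgue_measure_unique => //.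
move=> _ [[p q]] _ <- /=; rewrite /mscale /pushforward/=.
rewrite [X in (_ * lebesgue_measure X)%E](_ :
  _ = `](p / a), (q / a)]%classic); last first.
  by apply/seteqP; split=> y;
    rewrite /= !in_itv/= /h ltr_pdivrMr// ler_pdivlMr// mulrC.
rewrite !lebesgue_measure_itv/= !lte_fin ltr_pM2r ?invr_gt0//.
case: ifP => // _; last by rewrite mule0.
by rewrite -!EFinD -EFinM; congr (_%:E); field; rewrite gt_eqF.
Qed.

Lemma poweR2 (x : \bar R) : (0 <= x)%E -> (x `^ 2 = x ^+ 2)%E.
Proof.
case: x => [r||]// r0; first by rewrite poweR_EFin powR_mulrn// EFin_expe.
by rewrite poweRyr// expe2 mulyy.
Qed.

Lemma Lnorm2_sqr (f : R -> R) :
  ('N[mu]_2%:E[EFin \o f] ^+ 2 = \int[mu]_x (f x ^+ 2)%:E)%E.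
Proof.
rewrite -poweR2 ?Lnorm_ge0// poweR_Lnorm//; apply: eq_integral => x _ /=.
by rewrite powR_mulrn// real_normK// num_real.
Qed.

(** Hölder with exponents 2 and 2, applied to [sqrt p] and [sqrt p * h]. It is an inequality in the
    extended reals, so either side may be infinite. *)
Lemma weighted_cauchy_schwarz (p h : R -> R) :
  measurable_fun [set: R] p -> measurable_fun [set: R] h ->
  (forall x, 0 <= p x) ->
  ((\int[mu]_x (p x * `|h x|)%:E) ^+ 2 <=
   (\int[mu]_x (p x)%:E) * \int[mu]_x (p x * h x ^+ 2)%:E)%E.
Proof.
move=> mp mh p0.
have msp : measurable_fun [set: R] (fun x => Num.sqrt (p x)).
  by apply: measurableT_comp => //; apply: continuous_measurable_fun;
    exact: sqrt_continuous.
have msph : measurable_fun [set: R] (fun x => Num.sqrt (p x) * h x).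
  exact: measurable_funM.
have := @hoelder _ _ _ mu _ _ 2 2 msp msph (ltr0n _ _) (ltr0n _ _).
have -> : ((2:R)^-1 + 2^-1 = 1) by field.
move=> /(_ erefl); rewrite Lnorm1 -lee_sqr; last 2 first.
- exact: integral_ge0.
- by rewrite mule_ge0// Lnorm_ge0.
rewrite [in X in (_ <= X)%E -> _]expe2 muleACA -!expe2 !Lnorm2_sqr.
rewrite (eq_integral (fun x : measurableTypeR R => (p x * `|h x|)%:E));
  last first.
  move=> x _ /=; rewrite normrM normrM ger0_norm ?sqrtr_ge0//.
  by rewrite mulrA -expr2 sqr_sqrtr.
rewrite [X in (_ <= X * _)%E -> _](eq_integral (fun x : measurableTypeR R =>
  (p x)%:E)); last first.
  by move=> x _ /=; rewrite sqr_sqrtr.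
rewrite [X in (_ <= _ * X)%E -> _](eq_integral (fun x : measurableTypeR R =>
  (p x * h x ^+ 2)%:E))//.
by move=> x _ /=; rewrite exprMn sqr_sqrtr.
Qed.

Lemma integral_reflect (f : R -> \bar R) (x : R) :
  measurable_fun [set: R] f ->
  (\int[mu]_y f (x - y)%R = \int[mu]_y f y)%E.
Proof.
move=> mf; rewrite integralE [RHS]integralE.
rewrite -(ge0_integral_reflect x (measurable_funepos mf))//.
rewrite -(ge0_integral_reflect x (measurable_funeneg mf))//.
by congr (_ - _)%E; apply: eq_integral => y _; rewrite ?funeposE ?funenegE.
Qed.

Lemma integrable_reflect (f : R -> R) (x : R) :
  mu.-integrable [set: R] (EFin \o f) ->
  mu.-integrable [set: R] (fun y => (f (x - y))%:E).
Proof.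
move=> /integrableP[mf foo]; apply/integrableP; split.
  by apply: measurableT_comp mf _; apply: measurable_funB.
have /= := @ge0_integral_reflect (fun y => `|(f y)%:E|%E) x.
move=> ->//; exact: (@measurableT_comp _ _ _ _ _ _ abse _ (EFin \o f)).
Qed.

Lemma ae_lebesgue_filter : Filter (nbhs (almost_everywhere mu)).
Proof. exact: (ae_filter_ringOfSetsType (lebesgue_measure :
  {measure set rT -> \bar R})). Qed.

Lemma EFin_Rintegral (f : R -> R) : mu.-integrable [set: R] (EFin \o f) ->
  ((\int[mu]_y f y)%R%:E = \int[mu]_y (f y)%:E)%E.
Proof. by move=> intf; rewrite fineK//; exact: integrable_fin_num. Qed.

Lemma integrable_bounded_mul (h f : R -> R) : measurable_fun [set: R] h ->
  (forall t, `|h t| <= 1) -> mu.-integrable [set: R] (EFin \o f) ->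
  mu.-integrable [set: R] (fun t => (h t * f t)%:E).
Proof.
move=> mh h1 mf; apply: (le_integrable _ _ _ mf) => //.
- apply/measurable_EFinP; apply: measurable_funM => //.
  by apply/measurable_EFinP; exact: measurable_int mf.
- by move=> t _ /=; rewrite lee_fin normrM ler_piMl.
Qed.

Lemma integrable_norm_add (f1 f2 : R -> R) :
  mu.-integrable [set: R] (EFin \o f1) ->
  mu.-integrable [set: R] (EFin \o f2) ->
  mu.-integrable [set: R] (fun y => (`|f1 y| + `|f2 y|)%:E).
Proof.
move=> i1 i2; under eq_fun do rewrite EFinD.
by apply: integrableD => //; exact: integrable_norm.
Qed.

Lemma integral_FTC (f F : R -> R) (a b : R) : a < b -> continuous f ->
  (forall x : R, is_derive x 1 F (f x)) ->
  (\int[mu]_(x in `[a, b]) (f x)%:E = (F b - F a)%:E)%E.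
Proof.
move=> ab cf dF.
have cF : continuous F.
  move=> x; apply: differentiable_continuous; apply/derivable1_diffP.
  exact: (@ex_derive _ _ _ _ _ _ _ (dF x)).
rewrite (@continuous_FTC2 _ _ F)//.
- exact: continuous_subspaceT.
- split.
  + by move=> x _; exact: (@ex_derive _ _ _ _ _ _ _ (dF x)).
  + by apply: cvg_at_right_filter; exact: cF.
  + by apply: cvg_at_left_filter; exact: cF.
- by move=> x _; rewrite derive1E; exact: (@derive_val _ _ _ _ _ _ _ (dF x)).
Qed.

Import HBNNSimple.

(* The integral of a nonnegative function, measurable or not, is the supremum of
   the integrals of the simple functions below it. *)
Lemma le_integral_cst (D : set R) (g : R -> \bar R) (M : \bar R) :
  measurable (D : set rT) -> (0 <= M)%E ->
  (forall x, D x -> (0 <= g x)%E) -> (forall x, D x -> (g x <= M)%E) ->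
  (\int[mu]_(x in D) g x <= M * mu D)%E.
Proof.
move=> mD M0 g0 gM; rewrite -(@integral_cst _ rT R mu D mD M).
rewrite [leLHS]integral_mkcond [leRHS]integral_mkcond.
rewrite !ge0_integralTE//; last 2 first.
- by move=> x; rewrite patchE; case: ifPn.
- by move=> x; rewrite patchE; case: ifPn => // /set_mem /g0.
apply: ereal_sup_le => _ [h hg <-]; exists h => // x.
apply: (le_trans (hg x)); rewrite !patchE; case: ifPn => // /set_mem Dx.
exact: gM.
Qed.

Lemma measurable_cosM z : measurable_fun [set: R] (fun t => cos (t * z) : R).
Proof.
apply: continuous_measurable_fun => t; apply: continuous_comp;
  last exact: continuous_cos.
by apply: cvgM; [exact: cvg_id|exact: cvg_cst].
Qed.

Lemma measurable_sinM z : measurable_fun [set: R] (fun t => sin (t * z)).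
Proof.
apply: continuous_measurable_fun => t; apply: continuous_comp;
  last exact: continuous_sin.
by apply: cvgM; [exact: cvg_id|exact: cvg_cst].
Qed.

End LebesgueIntegral.

(** * The tent function, its Fourier transform, and the multiplication formula *)

Section TentTransform.
Context {R : realType}.
Local Notation mu := (@lebesgue_measure R).
Local Notation rT := (measurableTypeR R).

Definition tent (a t : R) : R := Num.max 0 (1 - `|t| / a).

Lemma tent_ge0 a t : 0 <= tent a t.
Proof. by rewrite /tent le_max lexx. Qed.

Lemma tent_le1 a t : 0 < a -> tent a t <= 1.
Proof. by move=> a0; rewrite /tent ge_max ler01/= gerBl divr_ge0// ltW. Qed.

Lemma tentN a t : tent a (- t) = tent a t.
Proof. by rewrite /tent normrN. Qed.

Lemma tent_eq0 a t : 0 < a -> a <= `|t| -> tent a t = 0.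
Proof. by move=> a0 at1; apply/max_idPl;
  rewrite subr_le0 ler_pdivlMr// mul1r. Qed.

Lemma tentE a t : 0 < a -> `|t| <= a -> tent a t = 1 - `|t| / a.
Proof. by move=> a0 at1; apply/max_idPr;
  rewrite subr_ge0 ler_pdivrMr// mul1r. Qed.

Lemma measurable_tent a : measurable_fun [set: R] (tent a).
Proof.
apply: measurable_maxr => //; apply: measurable_funB => //.
by apply: measurable_funM.
Qed.

Lemma integrable_tent a : 0 < a -> mu.-integrable [set: R] (EFin \o tent a).
Proof.
move=> a0; apply: (@le_integrable _ _ _ mu _ _ _ (EFin \o \1_(`[- a, a]%classic
  : set (measurableTypeR R)))) => //.
- by apply/measurable_EFinP; exact: measurable_tent.
- move=> t _ /=; rewrite indicE lee_fin (ger0_norm (tent_ge0 _ _)) ger0_norm//.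
  have [ta|ta] := leP `|t| a.
    by rewrite mem_set ?tent_le1//= in_itv/= -ler_norml.
  by rewrite tent_eq0 ?(ltW ta)// ler0n.
- exact: integrable_indic_itv.
Qed.

(* The Fourier transform of tent a, except at z = 0, where the division gives 0
   instead of the value a; only almost every z matters. *)
Definition fejer (a z : R) : R := 2 * (1 - cos (a * z)) / (a * z ^+ 2).

(** The tent is affine on each half of [[-a, a]], so an explicit primitive on each half suffices. *)
Lemma integral_tent_cos (a z : R) : 0 < a -> z != 0 ->
  (\int[mu]_t (tent a t * cos (t * z))%:E = (fejer a z)%:E)%E.
Proof.
move=> a0 z0.
(* The parameter [s] is the sign of the slope: [s = 1] gives the integrand on [[-a, 0]], [s = -1] on
   [[0, a]]. The primitive [G s] comes from integration by parts. *)
pose g (s t : R) := (1 + s * t / a) * cos (t * z).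
pose G (s t : R) := (1 + s * t / a) * (sin (t * z) / z) +
  s * (cos (t * z) / (a * z ^+ 2)).
have dG (s t : R) : is_derive t 1 (G s) (g s t).
  rewrite /G /g; apply: is_derive_eq.
  rewrite /GRing.scale/= ?mulr1 ?mul1r ?mul0r ?mulr0 ?add0r ?addr0.
  by field; rewrite z0 gt_eqF.
have cg s : continuous (g s).
  move=> t; apply: cvgM.
    apply: cvgD; first exact: cvg_cst.
    by apply: cvgM; [apply: cvgM;
      [exact: cvg_cst|exact: cvg_id]|exact: cvg_cst].
  apply: continuous_comp; last exact: continuous_cos.
  by apply: cvgM; [exact: cvg_id|exact: cvg_cst].
have -> : (\int[mu]_t (tent a t * cos (t * z))%:E =
   \int[mu]_(t in `[(- a)%R, a]) (tent a t * cos (t * z))%:E)%E.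
  rewrite [RHS]integral_mkcond; apply: eq_integral => t _; rewrite patchE.
  case: ifPn => //; rewrite notin_setE/= in_itv/= -ler_norml => /negP;
    rewrite -ltNge => at1.
  by rewrite tent_eq0 ?mul0r// ltW.
rewrite (@itv_bndbnd_setU _ _ _ (BRight 0)) ?bnd_simp; [|lra|lra].
have mg : measurable_fun [set: R] (fun t => (tent a t * cos (t * z))%:E).
  apply/measurable_EFinP; apply: measurable_funM; first exact: measurable_tent.
  exact: measurable_cosM.
rewrite integral_setU//=; last 2 first.
- exact: measurable_funTS.
- by apply/disj_setPS => t [] /=;
  rewrite !in_itv/= => /andP[_ h1] /andP[h2 _]; lra.
rewrite integral_itv_obnd_cbnd; last by apply: measurable_funTS.
rewrite [X in (X + _)%E](_ :
  _ = \int[mu]_(t in `[(- a)%R, 0%R]) (g 1 t)%:E)%E; last first.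
  apply: eq_integral => t; rewrite inE/= in_itv/= => /andP[t1 t2].
  rewrite /g tentE ?ler0_norm//; last by lra.
  by congr (_%:E); congr (_ * _); field; rewrite gt_eqF.
rewrite [X in (_ + X)%E](_ : _ = \int[mu]_(t in `[0%R, a]) (g (-1) t)%:E)%E;
  last first.
  apply: eq_integral => t; rewrite inE/= in_itv/= => /andP[t1 t2].
  rewrite /g tentE ?ger0_norm//.
  by congr (_%:E); congr (_ * _); field; rewrite gt_eqF.
rewrite (@integral_FTC _ _ (G 1))//; last lra.
rewrite (@integral_FTC _ _ (G (-1)))//.
rewrite -EFinD /G /fejer; congr (_%:E).
rewrite !mul0r sin0 cos0 mulNr sinN cosN.
by field; rewrite z0 gt_eqF.
Qed.

Lemma integrable_tent_bounded a (h : R -> R) : 0 < a ->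
  measurable_fun [set: R] h ->
  (forall t, `|h t| <= 1) ->
  mu.-integrable [set: R] (fun t => (tent a t * h t)%:E).
Proof.
move=> a0 mh h1; apply: (le_integrable _ _ _ (integrable_tent a0)) => //.
- by apply/measurable_EFinP; apply: measurable_funM => //;
  exact: measurable_tent.
- by move=> t _ /=; rewrite lee_fin normrM ler_piMr.
Qed.

(** The integrand is odd, so reflection at 0 makes the integral equal to its opposite; being finite,
    it is 0. *)
Lemma integral_tent_sin (a z : R) : 0 < a ->
  (\int[mu]_t (tent a t * sin (t * z))%:E = 0)%E.
Proof.
move=> a0.
have ig := integrable_tent_bounded a0 (measurable_sinM z) (fun t => sin_max _).
have := integral_reflect 0 (measurable_int _ ig).
rewrite (eq_integral (fun t : measurableTypeR R =>
  (-1)%:E * (tent a t * sin (t * z))%:E)%E); last first.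
  by move=> t _; rewrite sub0r tentN mulNr sinN mulrN EFinN EFinN mulN1e.
rewrite integralZl//.
have : (\int[mu]_t (tent a t * sin (t * z))%:E \is a fin_num)%E
  by exact: integrable_fin_num.
by move=> /fineK <-; rewrite -EFinM => -[] h; congr (_%:E); lra.
Qed.

(* Real part of the Fourier transform of f1 + i f2; its imaginary part is
   fourier_re f2 (- f1). *)
Definition fourier_re (f1 f2 : R -> R) (t : R) : R :=
  \int[mu]_y (cos (t * y) * f1 y + sin (t * y) * f2 y).

Lemma measurable_fejer a : measurable_fun [set: R] (fejer a).
Proof.
apply: measurable_funM.
  apply: measurable_funM => //; apply: measurable_funB => //.
  by under eq_fun do rewrite mulrC; exact: measurable_cosM.
(* The reciprocal is discontinuous at 0; its measurability is taken from the real power of exponent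
   -1, with which it agrees at [z = 0] as well. *)
have -> : (fun z : R => (a * z ^+ 2)^-1) = (fun z =>
  a^-1 * ((z ^+ 2) `^ (- 1))).
  by apply/funext => z; rewrite invfM powR_inv1// sqr_ge0.
apply: measurable_funM => //.
apply: (@measurableT_comp _ _ _ _ _ _ (fun x : R => x `^ (- 1)));
  [exact: measurable_powR|exact: exprn_measurable].
Qed.

Lemma integrable_fourier_re (f1 f2 : R -> R) (t : R) :
  mu.-integrable [set: R] (EFin \o f1) ->
  mu.-integrable [set: R] (EFin \o f2) ->
  mu.-integrable [set: R] (fun y =>
    (cos (t * y) * f1 y + sin (t * y) * f2 y)%:E).
Proof.
move=> i1 i2; under eq_fun do rewrite EFinD.
apply: integrableD => //; apply: integrable_bounded_mul => //.
- by under eq_fun do rewrite mulrC; exact: measurable_cosM.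
- by move=> y; exact: cos_max.
- by under eq_fun do rewrite mulrC; exact: measurable_sinM.
- by move=> y; exact: sin_max.
Qed.

(** The function is even continuous, by dominated convergence with the bound [|f1| + |f2|]. *)
Lemma measurable_fourier_re (f1 f2 : R -> R) :
  mu.-integrable [set: R] (EFin \o f1) ->
  mu.-integrable [set: R] (EFin \o f2) ->
  measurable_fun [set: R] (fourier_re f1 f2).
Proof.
move=> i1 i2; apply: continuous_measurable_fun => t.
have := @continuity_under_integral R _ _ mu (fun t y =>
  cos (t * y) * f1 y + sin (t * y) * f2 y) setT measurableT (t - 1) (t + 1)
  (fun t _ => integrable_fourier_re t i1 i2) _ (fun y => `|f1 y| + `|f2 y|).
apply.
- apply/nearW => y _ s _; apply: cvgD; apply: cvgM;
  [|exact: cvg_cst| |exact: cvg_cst].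
  + by apply: continuous_comp; [apply: cvgM;
    [exact: cvg_id|exact: cvg_cst]|exact: continuous_cos].
  + by apply: continuous_comp; [apply: cvgM;
    [exact: cvg_id|exact: cvg_cst]|exact: continuous_sin].
- exact: integrable_norm_add.
- move=> s _; apply/nearW => y _; rewrite (le_trans (ler_normD _ _))// !normrM.
  by rewrite lerD// ler_piMl// ?cos_max ?sin_max.
- by rewrite inE/= in_itv/=; apply/andP; split; lra.
Qed.

(** The multiplication formula: Fubini moves the Fourier transform from [f1 + i f2] onto the
    modulated tent. The left-hand side is a real part; [f2] drops out on the right because its
    coefficient is the integral of a tent against a sine. *)
Lemma fejer_multiplication (a x : R) (f1 f2 : R -> R) : 0 < a ->
  mu.-integrable [set: R] (EFin \o f1) ->
  mu.-integrable [set: R] (EFin \o f2) ->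
  (\int[mu]_t (tent a t * (cos (t * x) * fourier_re f1 f2 t
     - sin (t * x) * fourier_re f2 (\- f1) t))%:E =
   \int[mu]_y (fejer a (x - y) * f1 y)%:E)%E.
Proof.
move=> a0 i1 i2.
have iN1 : mu.-integrable [set: R] (EFin \o (\- f1)).
  exact: (integrableN i1).
(* The joint integrand, after the formulas for the cosine and sine of a difference. *)
pose k (ty : rT * rT) : R := tent a ty.1 * (cos (ty.1 * (x - ty.2)) * f1 ty.2 +
   sin (ty.1 * (ty.2 - x)) * f2 ty.2).
have mf1 : measurable_fun [set: R] f1.
  by apply/measurable_EFinP; exact: measurable_int i1.
have mf2 : measurable_fun [set: R] f2.
  by apply/measurable_EFinP; exact: measurable_int i2.
have mk : measurable_fun [set: rT * rT] (EFin \o k).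
  apply/measurable_EFinP; apply: measurable_funM.
    exact: (measurableT_comp (measurable_tent a) measurable_fst).
  apply: measurable_funD; apply: measurable_funM.
  - apply: measurableT_comp; first by apply: continuous_measurable_fun;
    exact: continuous_cos.
    by apply: measurable_funM => //; apply: measurable_funB.
  - exact: (measurableT_comp mf1 measurable_snd).
  - apply: measurableT_comp; first by apply: continuous_measurable_fun;
    exact: continuous_sin.
    by apply: measurable_funM => //; apply: measurable_funB.
  - exact: (measurableT_comp mf2 measurable_snd).
(* Tonelli's criterion: [|k (t, y)|] is at most [tent a t * (|f1 y| + |f2 y|)], a product of
   integrable functions. *)
have ik : (mu \x mu)%E.-integrable [set: rT * rT] (EFin \o k).
  apply/integrable12ltyP => //.
  pose M := (\int[mu]_y (`|f1 y| + `|f2 y|)%:E)%E.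
  have iM : mu.-integrable [set: R] (fun y => (`|f1 y| + `|f2 y|)%:E).
    exact: integrable_norm_add.
  have Mfin : (M \is a fin_num)%E by exact: integrable_fin_num.
  apply: (@le_lt_trans _ _ (\int[mu]_t (M * (tent a t)%:E))%E).
    apply: ge0_le_integral => //.
    - by move=> t _; exact: integral_ge0.
    - apply: (measurable_fun_fubini_tonelli_F (abse \o (EFin \o k))) => //.
      exact: measurableT_comp.
      by move=> z; exact: abse_ge0.
    - by apply: measurable_funeM; apply/measurable_EFinP;
      exact: measurable_tent.
    - move=> t _; rewrite muleC -ge0_integralZl_EFin ?tent_ge0//; last first.
        exact: measurable_int iM.
      apply: ge0_le_integral => //.
      + by apply: measurableT_comp => //;
        exact: (measurableT_comp mk (measurable_pair1 t)).
      + by apply: measurable_funeM; exact: measurable_int iM.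
      + move=> y _ /=; rewrite lee_fin normrM ger0_norm ?tent_ge0//.
        rewrite ler_wpM2l ?tent_ge0// (le_trans (ler_normD _ _))// !normrM.
        by rewrite lerD// ler_piMl// ?cos_max ?sin_max.
  have it : (\int[mu]_t (tent a t)%:E \is a fin_num)%E.
    by apply: integrable_fin_num => //; exact: integrable_tent.
  rewrite -(fineK Mfin) ge0_integralZl_EFin//.
  - by rewrite -(fineK it) -EFinM ltry.
  - by move=> t _; rewrite lee_fin tent_ge0.
  - by apply/measurable_EFinP; exact: measurable_tent.
  - by rewrite fine_ge0//; exact: integral_ge0.
rewrite (eq_integral (fun t : rT => \int[mu]_y (k (t, y))%:E)%E); last first.
  move=> t _.
  have iA := integrable_fourier_re t i1 i2.
  have iB := integrable_fourier_re t i2 iN1.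
  rewrite /fourier_re.
  rewrite -[cos (t * x) * _]RintegralZl// -[sin (t * x) * _]RintegralZl//.
  rewrite -RintegralB//; last 2 first.
  - exact: (integrableZl measurableT (cos (t * x)) iA).
  - exact: (integrableZl measurableT (sin (t * x)) iB).
  have iAB := integrableB measurableT
    (integrableZl measurableT (cos (t * x)) iA)
    (integrableZl measurableT (sin (t * x)) iB).
  rewrite -RintegralZl// EFin_Rintegral.
    apply: eq_integral => y _; rewrite /k/= !mulrBr cosB sinB; congr (_%:E);
      ring.
  exact: (integrableZl measurableT (tent a t) iAB).
rewrite [LHS](Fubini ik).
have mG := measurable_fubini_G ik.
(* The point [y = x] is removed on both sides, because [fejer a 0] is 0 and not the integral of the
   tent. *)
rewrite -[LHS](@integral_setD1 _ _ x)//; last 2 first.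
- exact: measurableD.
- exact: measurable_funTS mG.
rewrite -[RHS](@integral_setD1 _ _ x)//; last 2 first.
- exact: measurableD.
- apply/measurable_EFinP/measurable_funTS; apply: measurable_funM => //.
  by apply: measurableT_comp (measurable_fejer a) _; apply: measurable_funB.
apply: eq_integral => y; rewrite inE /= => -[_ yx].
have xy0 : x - y != 0 by rewrite subr_eq0 eq_sym; apply/eqP.
have iC := integrable_tent_bounded a0 (measurable_cosM (x - y)) (fun t =>
  cos_max _).
have iS := integrable_tent_bounded a0 (measurable_sinM (y - x)) (fun t =>
  sin_max _).
transitivity (\int[mu]_t ((f1 y)%:E * (tent a t * cos (t * (x - y)))%:E +
     (f2 y)%:E * (tent a t * sin (t * (y - x)))%:E))%E.
  by apply: eq_integral => t _ /=; rewrite /k/=; congr (_%:E); ring.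
rewrite integralD//; last 2 first.
- exact: integrableZl.
- exact: integrableZl.
rewrite integralZl// integralZl// integral_tent_cos// integral_tent_sin//.
by rewrite mule0 adde0 -EFinM mulrC.
Qed.

End TentTransform.

(** * The Fejér kernel: decay, mass, and approximation of the identity *)

Section FejerKernel.
Context {R : realType}.
Local Notation mu := (@lebesgue_measure R).
Local Notation rT := (measurableTypeR R).

Lemma fejer_ge0 (a z : R) : 0 < a -> 0 <= fejer a z.
Proof.
by move=> a0; rewrite divr_ge0// mulr_ge0 ?subr_ge0 ?cos_le1 ?sqr_ge0 ?(ltW a0).
Qed.

Lemma fejer_scale (a z : R) : 0 < a -> fejer a z = a * fejer 1 (a * z).
Proof.
move=> a0; have [->|z0] := eqVneq z 0;
  first by rewrite /fejer !mulr0 cos0 subrr !mulr0 !mul0r mulr0.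
by rewrite /fejer !mul1r; field; rewrite z0 gt_eqF.
Qed.

Lemma fejer_sqr_le (a z : R) : 0 < a -> z ^+ 2 * fejer a z <= 4 / a.
Proof.
move=> a0; have [->|z0] := eqVneq z 0.
  by rewrite expr0n mul0r divr_ge0// ltW.
have -> : z ^+ 2 * fejer a z = 2 * (1 - cos (a * z)) / a.
  by rewrite /fejer; field; rewrite z0 gt_eqF.
by rewrite ler_pM2r ?invr_gt0//; have := cos_geN1 (a * z); lra.
Qed.

(** For [z != 0] the kernel is the cosine transform of a nonnegative function, hence at most its
    integral. *)
Lemma fejer_le_integral_tent (a z : R) : 0 < a ->
  ((fejer a z)%:E <= \int[mu]_t (tent a t)%:E)%E.
Proof.
move=> a0; have [->|z0] := eqVneq z 0.
  rewrite /fejer mulr0 cos0 subrr mulr0 mul0r; apply: integral_ge0 => t _.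
  by rewrite lee_fin tent_ge0.
rewrite -integral_tent_cos//; apply: le_integral => //.
- by apply: integrable_tent_bounded => // [|t];
  [exact: measurable_cosM|exact: cos_max].
- exact: integrable_tent.
- by move=> t _; rewrite lee_fin ler_piMr ?tent_ge0 ?cos_le1.
Qed.

Lemma oneDsqr_inv_ge0 (z : R) : 0 <= (oneDsqr z)^-1.
Proof. by rewrite invr_ge0 addr_ge0// sqr_ge0. Qed.

(** Adding the bounds on [fejer a z] and on [z ^+ 2 * fejer a z] bounds
    [(1 + z ^+ 2) * fejer a z]. *)
Lemma fejer_le_cauchy (a : R) : 0 < a ->
  exists2 A : R, 0 <= A & forall z, fejer a z <= A * (oneDsqr z)^-1.
Proof.
move=> a0; pose M := (\int[mu]_t (tent a t)%:E)%E.
have Mfin : (M \is a fin_num)%E by apply: integrable_fin_num => //;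
  exact: integrable_tent.
have M0 : 0 <= fine M.
  by rewrite fine_ge0//; apply: integral_ge0 => t _; rewrite lee_fin tent_ge0.
exists (fine M + 4 / a); first by rewrite addr_ge0// divr_ge0// ltW.
move=> z; have z1 : 0 < oneDsqr z by rewrite ltr_pwDl// sqr_ge0.
rewrite ler_pdivlMr// mulrC mulrDl mul1r lerD ?fejer_sqr_le//.
by rewrite -lee_fin fineK// fejer_le_integral_tent.
Qed.

Lemma measurable_cauchy : measurable_fun [set: R] (fun z : R => (oneDsqr z)^-1).
Proof. by apply: continuous_measurable_fun; exact: continuous_oneDsqrV. Qed.

Lemma integrable_cauchy : mu.-integrable [set: R] (fun z : R =>
  ((oneDsqr z)^-1)%:E).
Proof.
have mc := measurable_cauchy.
apply/integrableP; split; first exact/measurable_EFinP.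
under eq_integral do rewrite gee0_abs ?lee_fin ?oneDsqr_inv_ge0//.
have -> := ge0_symfun_integralT (f := fun z : R => (oneDsqr z)^-1)
  oneDsqr_inv_ge0 continuous_oneDsqrV _; last first.
  by move=> z /=; rewrite /oneDsqr sqrrN.
rewrite (_ : [set x : R | 0 <= x] = `[0, +oo[%classic); last first.
  by apply/seteqP; split=> y /=; rewrite in_itv/= andbT.
by rewrite integral0y_oneDsqr -EFinM ltry.
Qed.

(** Reflection and dilation reduce every case to [a = 1], [x = 0]. Only finiteness and positivity of
    the mass matter later, so its value is not computed: the first comes from the decay, the second
    from a lower bound on an interval. *)
Lemma fejer_mass : exists2 c : R, 0 < c &
  forall a x, 0 < a -> (\int[mu]_y (fejer a (x - y))%:E = c%:E)%E.
Proof.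
pose I := (\int[mu]_y (fejer 1 y)%:E)%E.
have f0 y : (0 <= (fejer (1 : R) y)%:E)%E by rewrite lee_fin fejer_ge0.
have mf (a : R) : measurable_fun [set: R] (fun y => (fejer a y)%:E).
  by apply/measurable_EFinP; exact: measurable_fejer.
have Ioo : (I < +oo)%E.
  have [A A0 fA] := fejer_le_cauchy (@ltr01 R).
  have iA := integrableZl measurableT A integrable_cauchy.
  apply: (@le_lt_trans _ _ (\int[mu]_y (A%:E * ((oneDsqr y)^-1)%:E))%E).
    apply: ge0_le_integral => //; last by move=> y _; rewrite -EFinM lee_fin.
    - exact: mf.
    - exact: (measurable_int _ iA).
  have : (\int[mu]_y (A%:E * ((oneDsqr y)^-1)%:E) \is a fin_num)%E.
    exact: integrable_fin_num.
  by move=> /fineK <-; exact: ltry.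
have Ifin : (I \is a fin_num)%E by rewrite ge0_fin_numE//; exact: integral_ge0.
have I0 : (0 < I)%E.
  (* On [[pi / 2, pi]] the cosine is nonpositive, so [fejer 1 y] is at least [2 / y ^+ 2], hence at
     least [2 / pi ^+ 2]. *)
  pose J : set rT := `[pi / 2, pi]%classic.
  have measJ : measurable J by exact: measurable_itv.
  apply: (@lt_le_trans _ _ (\int[mu]_(y in J) (2 / pi ^+ 2)%:E)%E).
    have p0 := pi_gt0 R.
    have mJ : mu J = (pi - pi / 2)%:E.
      rewrite /J lebesgue_measure_itv/= lte_fin ifT; last by lra.
      by rewrite EFinB.
    have -> : (\int[mu]_(y in J)
      (2 / pi ^+ 2)%:E = (2 / pi ^+ 2)%:E * mu J)%E by exact: integral_cst.
    rewrite mJ.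
    by rewrite -EFinM lte_fin mulr_gt0 ?divr_gt0 ?exprn_gt0// subr_gt0; lra.
  apply: (@le_trans _ _ (\int[mu]_(y in J) (fejer 1 y)%:E)%E); last first.
    by apply: ge0_subset_integral => //; exact: mf.
  apply: ge0_le_integral => //.
  - by move=> y _; rewrite lee_fin divr_ge0// sqr_ge0.
  - by apply: measurable_funTS; exact: mf.
  - move=> y; rewrite /J/= in_itv/= => /andP[y1 y2].
    have p0 := pi_gt0 R.
    have cy : cos y <= 0.
      move: y1; rewrite le_eqVlt => /predU1P[<-|y1];
        first by rewrite cos_pihalf.
      rewrite -(cos_pihalf R) ltW// ltr_cos//; rewrite in_itv/=; apply/andP;
        split; lra.
    rewrite lee_fin /fejer !mul1r ler_pM// ?invr_ge0 ?sqr_ge0//; first by lra.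
    rewrite lef_pV2 ?posrE ?exprn_gt0//; last lra.
    by rewrite lerXn2r ?nnegrE//; lra.
exists (fine I); first by rewrite fine_gt0// I0.
move=> a x a0; rewrite fineK//.
rewrite (@ge0_integral_reflect R (fun y => (fejer a y)%:E))//; last first.
  by move=> y; rewrite lee_fin fejer_ge0.
rewrite -[RHS](@ge0_integral_dilate R (fun y => (fejer 1 y)%:E) a)//.
by apply: eq_integral => y _; rewrite fejer_scale.
Qed.

Definition square_integrable (f : R -> R) :=
  measurable_fun [set: R] f /\ (\int[mu]_y (f y ^+ 2)%:E < +oo)%E.

Lemma square_integrableP (f : R -> R) : square_integrable f ->
  mu.-integrable [set: R] (fun y => (f y ^+ 2)%:E).
Proof.
move=> [mf foo]; apply/integrableP; split.
  by apply/measurable_EFinP; exact: measurable_funX.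
by under eq_integral do rewrite gee0_abs ?lee_fin ?sqr_ge0//.
Qed.

Lemma integrable_pairing (k f : R -> R) (A x : R) : 0 <= A ->
  measurable_fun [set: R] k -> (forall z, `|k z| <= A * (oneDsqr z)^-1) ->
  square_integrable f ->
  mu.-integrable [set: R] (fun y => (k (x - y) * f y)%:E).
Proof.
move=> A0 mk kA f2.
have mkx : measurable_fun [set: R] (fun y => k (x - y)).
  by apply: measurableT_comp mk _; apply: measurable_funB.
have ic := integrable_reflect x integrable_cauchy.
have := integrableZl measurableT A (integrableD measurableT ic
  (square_integrableP f2)).
move=> /le_integrable; apply => //.
  by apply/measurable_EFinP; apply: measurable_funM => //; exact: f2.1.
move=> y _ /=; rewrite lee_fin normrM.
have w0 := oneDsqr_inv_ge0 (x - y).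
have w1 : (oneDsqr (x - y))^-1 <= 1 by exact: oneDsqrV_le1.
rewrite [leRHS]ger0_norm; last by rewrite mulr_ge0// addr_ge0// sqr_ge0.
apply: (@le_trans _ _ (A * (oneDsqr (x - y))^-1 * `|f y|));
  first exact: ler_wpM2r.
rewrite -mulrA ler_wpM2l//.
rewrite -(real_normK (num_real (f y))).
(* For [w <= 1], the product [w * h] is at most [w + h ^+ 2]. *)
move: (normr_ge0 (f y)) w0 w1; move: (oneDsqr _)^-1 `|f y| => w h; nra.
Qed.

Lemma integrable_fejer_pairing (a x : R) (f : R -> R) : 0 < a ->
  square_integrable f ->
  mu.-integrable [set: R] (fun y => (fejer a (x - y) * f y)%:E).
Proof.
move=> a0 f2; have [A A0 fA] := fejer_le_cauchy a0.
apply: (integrable_pairing x A0 _ _ f2); first exact: measurable_fejer.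
by move=> z; rewrite ger0_norm ?fejer_ge0.
Qed.

(** Within distance [d] of [x], continuity gives an error [e] times the mass. Farther away the
    kernel is [O(1 / a)] times a Cauchy weight, against which [|f y - f x|] is integrable. *)
Lemma fejer_approximate_identity (c x : R) (f : R -> R) :
  (forall a, 0 < a -> (\int[mu]_y (fejer a (x - y))%:E = c%:E)%E) ->
  square_integrable f -> {for x, continuous f} ->
  forall e, 0 < e -> exists2 a0 : R, 0 < a0 & forall a, a0 <= a ->
    `|\int[mu]_y (fejer a (x - y) * f y) - c * f x| <= e * (c + 1).
Proof.
move=> cE f2 cf e e0.
have := cf; move/cvgrPdist_le => /(_ _ e0)/nbhs_ballP[d /= d0 fd].
(* For [|z| >= d], [1 / z ^+ 2] is at most [(1 + 1 / d ^+ 2) / (1 + z ^+ 2)]; with [fejer_sqr_le],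
   which gives the 4, the kernel is at most [C / a] times the Cauchy weight. *)
pose C := 4 * (1 + (d ^+ 2)^-1).
have C0 : 0 <= C by rewrite mulr_ge0// addr_ge0// invr_ge0 sqr_ge0.
pose g (y : R) := C * (oneDsqr (x - y))^-1 * `|f y - f x|.
have mfx : measurable_fun [set: R] (fun y => `|f y - f x|).
  by apply: measurableT_comp => //; apply: measurable_funB => //; exact: f2.1.
have ig : mu.-integrable [set: R] (EFin \o g).
  have i1 : mu.-integrable [set: R] (fun y =>
    ((C * (oneDsqr (x - y))^-1) * f y)%:E).
    apply: (@integrable_pairing (fun z => C * (oneDsqr z)^-1) f C x C0 _ _ f2).
      by apply: measurable_funM => //; exact: measurable_cauchy.
    by move=> z; rewrite ger0_norm// mulr_ge0// oneDsqr_inv_ge0.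
  have i2 := integrableZl measurableT (C * f x)
    (integrable_reflect x integrable_cauchy).
  have /le_integrable := integrableB measurableT i1 i2; apply => //.
    apply/measurable_EFinP; apply: measurable_funM => //.
    apply: measurable_funM => //.
    by apply: (measurableT_comp measurable_cauchy); apply: measurable_funB.
  move=> y _ /=; rewrite lee_fin /g normrM normr_id -normrM.
  by rewrite le_eqVlt; apply/orP; left; apply/eqP; congr `|_|; ring.
pose M := \int[mu]_y g y.
have M0 : 0 <= M by apply: Rintegral_ge0 => y _;
  rewrite mulr_ge0// mulr_ge0// oneDsqr_inv_ge0.
(* From [a >= M / e] the far part [M / a] is at most [e]; adding 1 keeps the threshold positive when
   [M = 0]. *)
exists (M / e + 1); first by rewrite ltr_wpDl// divr_ge0// ltW.
move=> a aM.
have a0 : 0 < a by apply: lt_le_trans aM; rewrite ltr_wpDl// divr_ge0// ltW.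
have if1 := integrable_fejer_pairing x a0 f2.
have if2 : mu.-integrable [set: R] (fun y => (fejer a (x - y))%:E).
  apply/integrableP; split.
    by apply/measurable_EFinP; apply: measurableT_comp (measurable_fejer a) _;
      apply: measurable_funB.
  by under eq_integral do rewrite gee0_abs ?lee_fin ?fejer_ge0//;
    rewrite cE// ltry.
have -> : \int[mu]_y (fejer a (x - y) * f y) - c * f x =
   \int[mu]_y (fejer a (x - y) * (f y - f x)).
  have -> : c * f x = \int[mu]_y (fejer a (x - y) * f x).
    by rewrite RintegralZr// /Rintegral cE.
  rewrite -RintegralB//; last exact: (integrableZr measurableT (f x) if2).
  by apply: eq_Rintegral => y _; rewrite mulrBr.
have if3 : mu.-integrable [set: R] (fun y =>
  (fejer a (x - y) * (f y - f x))%:E).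
  under eq_fun do rewrite mulrBr EFinB.
  apply: integrableB => //; exact: (integrableZr measurableT (f x) if2).
rewrite (le_trans (le_normr_Rintegral _ if3))//.
have -> : e * (c + 1) = e * c + e by ring.
apply: (@le_trans _ _ (e * c + a^-1 * M)); last first.
  rewrite lerD2l mulrC ler_pdivrMr// mulrC -ler_pdivrMr//.
  by apply: le_trans aM; rewrite lerDl.
have i4 := integrableZl measurableT e if2.
have i5 := integrableZl measurableT a^-1 ig.
have -> : e * c + a^-1 * M = \int[mu]_y (e * fejer a (x - y) + a^-1 * g y).
  rewrite RintegralD//; last first.
  by rewrite !RintegralZl// /Rintegral cE.
apply: le_Rintegral => //.
- exact: integrable_norm.
- exact: (integrableD measurableT i4 i5).
move=> y _; rewrite normrM (ger0_norm (fejer_ge0 _ a0)).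
have F0 := fejer_ge0 (x - y) a0.
have g0 : 0 <= a^-1 * g y.
  by rewrite mulr_ge0 ?invr_ge0 ?(ltW a0)// mulr_ge0// mulr_ge0//
    oneDsqr_inv_ge0.
have [xyd|xyd] := ltP `|x - y| d.
  rewrite -[leLHS]addr0 lerD// mulrC ler_wpM2r//.
  by rewrite distrC; apply: fd.
rewrite -[leLHS]add0r lerD//; first by rewrite mulr_ge0// ltW.
rewrite /g !mulrA ler_wpM2r//.
have z0 : 0 < (x - y) ^+ 2 by rewrite exprn_even_gt0//= -normr_gt0 (lt_le_trans
  d0).
have zd : d ^+ 2 <= (x - y) ^+ 2.
  by rewrite -(real_normK (num_real (x - y))) lerXn2r ?nnegrE// ltW.
have d2 : 0 < d ^+ 2 by rewrite exprn_gt0.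
have := fejer_sqr_le (x - y) a0.
rewrite -ler_pdivlMl// => /le_trans; apply.
have zV : ((x - y) ^+ 2)^-1 <= (1 + (d ^+ 2)^-1) / oneDsqr (x - y).
  have w1 : 0 < oneDsqr (x - y) by rewrite ltr_pwDl// sqr_ge0.
  rewrite ler_pdivlMr// /oneDsqr mulrDr mulr1 mulVf ?gt_eqF// addrC lerD2l.
  by rewrite lef_pV2.
rewrite [leRHS](_ : _ = (1 + (d ^+ 2)^-1) / oneDsqr (x - y) * (4 / a));
  last first.
  by rewrite /C; field; rewrite ?gt_eqF// ltr_pwDl// sqr_ge0.
by rewrite ler_wpM2r// divr_ge0// ltW.
Qed.

End FejerKernel.

(** * De la Vallée-Poussin kernels and the reproducing formula *)

Section Reproducing.
Context {R : realType}.
Local Notation mu := (@lebesgue_measure R).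
Local Notation rT := (measurableTypeR R).

Definition truncation (n : nat) (f : R -> R) (x : R) : R :=
  if x \in `[- n%:R, n%:R] then f x else 0.

Lemma measurable_truncation n f : measurable_fun [set: R] f ->
  measurable_fun [set: R] (truncation n f).
Proof.
move=> mf; rewrite (_ : truncation n f = (fun x =>
  \1_(`[- n%:R, n%:R]%classic : set R) x * f x)).
  by apply: measurable_funM => //; exact: measurable_indic.
apply/funext => x; rewrite /truncation indicE.
case: ifPn => xn; first by rewrite mem_set// mul1r.
by rewrite memNset ?mul0r//; exact/negP.
Qed.

Lemma integrable_truncation n f : square_integrable f ->
  mu.-integrable [set: R] (EFin \o truncation n f).
Proof.
move=> f2.
have i1 : mu.-integrable [set: R] (EFin \o \1_(`[- n%:R, n%:R]%classic :
  set rT)).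
  exact: integrable_indic_itv.
have := integrableD measurableT i1 (square_integrableP f2).
move=> /le_integrable; apply => //.
  by apply/measurable_EFinP; apply: measurable_truncation; exact: f2.1.
(* On [[-n, n]], [|f|] is dominated by [1 + f ^+ 2]. *)
move=> x _ /=; rewrite lee_fin [leRHS]ger0_norm ?addr_ge0 ?sqr_ge0//.
rewrite /truncation indicE; case: ifPn => xn;
  last by rewrite normr0 addr_ge0// sqr_ge0.
rewrite mem_set//= -(real_normK (num_real (f x))).
by move: `|f x| => h; nra.
Qed.

Lemma truncation_pairing_cvg (a x : R) (f : R -> R) : 0 < a ->
  square_integrable f ->
  (fun n => \int[mu]_y (fejer a (x - y) * truncation n f y)) @ \oo -->
  \int[mu]_y (fejer a (x - y) * f y).
Proof.
move=> a0 f2; have if1 := integrable_fejer_pairing x a0 f2.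
have mfx : measurable_fun [set: R] (fun y => fejer a (x - y)).
  by apply: measurableT_comp (measurable_fejer a) _; apply: measurable_funB.
have [] := @dominated_convergence _ rT R mu setT measurableT
  (fun n y => (fejer a (x - y) * truncation n f y)%:E)
  (fun y => (fejer a (x - y) * f y)%:E) (fun y => `|fejer a (x - y) * f y|%:E).
- move=> n; apply/measurable_EFinP; apply: measurable_funM => //.
  by apply: measurable_truncation; exact: f2.1.
- exact: measurable_int if1.
- apply/nearW => y _.
  (* At each point the truncations equal [f] as soon as [n >= |y|]. *)
  apply: cvg_near_cst.
  have [m ym] : exists m : nat, `|y| <= m%:R.
    by exists (Num.bound `|y|); rewrite ltW//; exact: archi_boundP.
  exists m => // n /= mn; rewrite /truncation in_itv/= -ler_norml ifT//.
  by rewrite (le_trans ym)// ler_nat.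
- exact: integrable_norm.
- apply/nearW => y n _; rewrite lee_fin /truncation; case: ifPn => // _.
  by rewrite mulr0 normr0.
move=> _ _ h; apply: fine_cvg.
by rewrite fineK//; exact: integrable_fin_num.
Qed.

Lemma fourier_re_bounded (f1 f2 : R -> R) t :
  mu.-integrable [set: R] (EFin \o f1) ->
  mu.-integrable [set: R] (EFin \o f2) ->
  `|fourier_re f1 f2 t| <= \int[mu]_y (`|f1 y| + `|f2 y|).
Proof.
move=> i1 i2; have it := integrable_fourier_re t i1 i2.
rewrite (le_trans (le_normr_Rintegral _ it))//; apply: le_Rintegral => //.
- exact: integrable_norm.
- exact: integrable_norm_add.
- move=> y _; rewrite (le_trans (ler_normD _ _))// !normrM.
  by rewrite lerD// ler_piMl// ?cos_max ?sin_max.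
Qed.

(* Equal to 1 on [-a, a] and supported in [-2a, 2a]. *)
Definition vallee_poussin (a t : R) : R := 2 * tent (2 * a) t - tent a t.
Definition vallee_poussin_kernel (a z : R) : R :=
  2 * fejer (2 * a) z - fejer a z.

(* Real part of e^(itx) times the Fourier transform of f1 + i f2. *)
Definition modulated (f1 f2 : R -> R) (x t : R) : R :=
  cos (t * x) * fourier_re f1 f2 t - sin (t * x) * fourier_re f2 (\- f1) t.

Lemma measurable_modulated (f1 f2 : R -> R) x :
  mu.-integrable [set: R] (EFin \o f1) ->
  mu.-integrable [set: R] (EFin \o f2) ->
  measurable_fun [set: R] (modulated f1 f2 x).
Proof.
move=> i1 i2; apply: measurable_funB; apply: measurable_funM.
- exact: measurable_cosM.
- exact: measurable_fourier_re.
- exact: measurable_sinM.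
- by apply: measurable_fourier_re => //; exact: (integrableN i1).
Qed.

Lemma integrable_tent_modulated (f1 f2 : R -> R) a x : 0 < a ->
  mu.-integrable [set: R] (EFin \o f1) ->
  mu.-integrable [set: R] (EFin \o f2) ->
  mu.-integrable [set: R] (fun t => (tent a t * modulated f1 f2 x t)%:E).
Proof.
move=> a0 i1 i2.
have iN1 : mu.-integrable [set: R] (EFin \o (\- f1)) by exact: (integrableN i1).
pose M := \int[mu]_y (`|f1 y| + `|f2 y|) + \int[mu]_y (`|f2 y| + `|(\- f1) y|).
have := integrableZl measurableT M (integrable_tent a0).
move=> /le_integrable; apply => //.
  apply/measurable_EFinP; apply: measurable_funM; first exact: measurable_tent.
  exact: measurable_modulated.
move=> t _ /=; rewrite lee_fin normrM mulrC [leRHS]normrM ler_wpM2r//.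
rewrite [leRHS]ger0_norm; last by rewrite addr_ge0// Rintegral_ge0.
rewrite (le_trans (ler_normB _ _))// !normrM lerD//.
- by rewrite (le_trans (ler_piMl _ (cos_max _)))// fourier_re_bounded.
- by rewrite (le_trans (ler_piMl _ (sin_max _)))// fourier_re_bounded.
Qed.

Lemma vallee_poussin_multiplication (a x : R) (f1 f2 : R -> R) : 0 < a ->
  mu.-integrable [set: R] (EFin \o f1) ->
  mu.-integrable [set: R] (EFin \o f2) ->
  \int[mu]_t (vallee_poussin a t * modulated f1 f2 x t) =
  2 * \int[mu]_y (fejer (2 * a) (x - y) * f1 y) -
    \int[mu]_y (fejer a (x - y) * f1 y).
Proof.
move=> a0 i1 i2; have a20 : 0 < 2 * a by rewrite mulr_gt0.
have j1 := integrable_tent_modulated x a0 i1 i2.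
have j2 := integrable_tent_modulated x a20 i1 i2.
rewrite /Rintegral -!(fejer_multiplication x _ i1 i2)//.
rewrite -!/(Rintegral _ _ _) -RintegralZl// -RintegralB//.
  by apply: eq_Rintegral => t _;
    rewrite /vallee_poussin -/(modulated f1 f2 x t); ring.
exact: (integrableZl measurableT 2 j2).
Qed.

Lemma integrable_vallee_poussin a : 0 < a ->
  mu.-integrable [set: R] (EFin \o vallee_poussin a).
Proof.
move=> a0; have a20 : 0 < 2 * a by rewrite mulr_gt0.
exact: (integrableB measurableT (integrableZl measurableT 2 (integrable_tent
  a20)) (integrable_tent a0)).
Qed.

Lemma vallee_poussin_eq1 a t : 0 < a -> `|t| <= a -> vallee_poussin a t = 1.
Proof.
move=> a0 ta; rewrite /vallee_poussin !tentE//; last 2 first.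
- by rewrite mulr_gt0.
- by rewrite (le_trans ta)// ler_peMl ?ler1n// ltW.
by field; rewrite gt_eqF.
Qed.

Lemma vallee_poussin_bound a t : 0 < a -> `|vallee_poussin a t| <= 3.
Proof.
move=> a0; have a20 : 0 < 2 * a by rewrite mulr_gt0.
rewrite /vallee_poussin ler_norml.
have := tent_ge0 a t; have := tent_ge0 (2 * a) t.
by have := tent_le1 t a0; have := tent_le1 t a20 => *; apply/andP; split; lra.
Qed.

(* AM-GM: |S| <= e + S^2 / e. *)
Lemma Rintegral_product_bound (w S d : R -> R) (C e : R) : 0 < e -> 0 <= C ->
  mu.-integrable [set: R] (EFin \o w) -> (forall t, `|w t| <= C) ->
  measurable_fun [set: R] S -> measurable_fun [set: R] d ->
    (forall t, 0 <= d t) ->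
  {ae mu, forall t, w t != 0 -> S t ^+ 2 <= d t} ->
  (`|\int[mu]_t (w t * S t)|%:E <=
    e%:E * (\int[mu]_t `|w t|)%R%:E + (C / e)%:E * \int[mu]_t (d t)%:E)%E.
Proof.
move=> e0 C0 iw wC mS md d0 Sd.
have mw : measurable_fun [set: R] w by apply/measurable_EFinP;
  exact: measurable_int iw.
have mwn : measurable_fun [set: R] (fun t => `|w t|) by exact: measurableT_comp.
have mwS : measurable_fun [set: R] (fun t => (w t * S t)%:E).
  by apply/measurable_EFinP; exact: measurable_funM.
apply: (@le_trans _ _ (\int[mu]_t `|(w t * S t)%:E|)%E).
  apply: (@le_trans _ _ `|\int[mu]_t (w t * S t)%:E|%E);
    last exact: le_abse_integral.
  (* If the extended integral is infinite, the real one is 0 by convention and the bound still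
     holds. *)
  by rewrite /Rintegral; case: (\int[mu]_t _)%E => [r||] //=;
    rewrite normr0 leey.
rewrite EFin_Rintegral; last exact: integrable_norm.
rewrite -ge0_integralZl_EFin ?(ltW e0)//; last exact/measurable_EFinP.
rewrite -[X in (_ + X)%E]ge0_integralZl_EFin ?divr_ge0 ?(ltW e0)//;
  last 2 first.
- by move=> t _; rewrite lee_fin.
- exact/measurable_EFinP.
have m1 : measurable_fun [set: R] (fun t => (e%:E * `|w t|%:E)%E).
  by apply: measurable_funeM; apply/measurable_EFinP.
have m2 : measurable_fun [set: R] (fun t => ((C / e)%:E * (d t)%:E)%E).
  by apply: measurable_funeM; apply/measurable_EFinP.
rewrite -ge0_integralD//; last 2 first.
- by move=> t _; rewrite mule_ge0// lee_fin ltW.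
- by move=> t _; rewrite -EFinM lee_fin mulr_ge0 ?divr_ge0 ?(ltW e0).
apply: ae_ge0_le_integral => //.
- exact: measurableT_comp.
- by move=> t _; rewrite adde_ge0// -EFinM lee_fin mulr_ge0 ?divr_ge0 ?(ltW e0).
- exact: emeasurable_funD.
apply: (@filterS _ _ ae_lebesgue_filter _ _ _ Sd) => t {}Sd _.
rewrite -!EFinM -EFinD lee_fin normrM.
have [->|wt0] := eqVneq (w t) 0.
  by rewrite normr0 mul0r mulr0 add0r mulr_ge0 ?divr_ge0 ?(ltW e0).
move: (Sd wt0) => {}Sd.
apply: (@le_trans _ _ (`|w t| * (e + d t / e))).
  rewrite ler_wpM2l//; rewrite -(real_normK (num_real (S t))) in Sd.
  have [Se|eS] := leP `|S t| e; first by rewrite ler_wpDr// divr_ge0// ltW.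
  rewrite ler_wpDl ?(ltW e0)// ler_pdivlMr//; apply: le_trans Sd.
  by rewrite expr2 ler_wpM2l// ltW.
rewrite mulrDr [e * _]mulrC lerD2l (_ : `|w t| * _ = `|w t| / e * d t);
  last by ring.
by rewrite ler_wpM2r// ler_wpM2r// invr_ge0 ltW.
Qed.

Lemma integrable_vallee_poussin_modulated (f1 f2 : R -> R) a x : 0 < a ->
  mu.-integrable [set: R] (EFin \o f1) ->
  mu.-integrable [set: R] (EFin \o f2) ->
  mu.-integrable [set: R] (fun t =>
    (vallee_poussin a t * modulated f1 f2 x t)%:E).
Proof.
move=> a0 i1 i2; have a20 : 0 < 2 * a by rewrite mulr_gt0.
have := integrableB measurableT
  (integrableZl measurableT 2 (integrable_tent_modulated x a20 i1 i2))
  (integrable_tent_modulated x a0 i1 i2).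
by apply: eq_integrable => // t _; rewrite /vallee_poussin -EFinM -EFinB;
  congr (_%:E); ring.
Qed.

(* |F_n - g|^2, with F_n the Fourier transform of the truncation of f1 + i f2
   to [-n, n] and g = g1 + i g2. *)
Definition spectral_error (f1 f2 g1 g2 : R -> R) (n : nat) (t : R) : R :=
  (fourier_re (truncation n f1) (truncation n f2) t - g1 t) ^+ 2 +
  (fourier_re (truncation n f2) (\- truncation n f1) t - g2 t) ^+ 2.

Lemma reproducing_formula (sigma c : R) (f1 f2 g1 g2 : R -> R) (x : R) :
  0 < sigma -> 0 < c ->
  (forall a x, 0 < a -> (\int[mu]_y (fejer a (x - y))%:E = c%:E)%E) ->
  square_integrable f1 -> square_integrable f2 -> {for x, continuous f1} ->
  measurable_fun [set: R] g1 -> measurable_fun [set: R] g2 ->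
  {ae mu, forall t, sigma < `|t| -> g1 t = 0 /\ g2 t = 0} ->
  (fun n => \int[mu]_t (spectral_error f1 f2 g1 g2 n t)%:E)%E @ \oo --> 0%E ->
  c * f1 x = \int[mu]_y (vallee_poussin_kernel sigma (x - y) * f1 y).
Proof.
move=> s0 c0 cE F1 F2 cf mg1 mg2 g0 Fg.
pose T a := \int[mu]_y (fejer a (x - y) * f1 y).
pose V a := 2 * T (2 * a) - T a.
(* On the Fourier side [V a - V sigma] tests the transform of [f] against [w], which vanishes on
   [[-sigma, sigma]]; outside, the transforms of the truncations tend to 0 in mean square. *)
have Vconst a : sigma <= a -> V a = V sigma.
  move=> sa; have a0 : 0 < a by exact: lt_le_trans sa.
  pose w t := vallee_poussin a t - vallee_poussin sigma t.
  have iw : mu.-integrable [set: R] (EFin \o w).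
    exact: (integrableB measurableT (integrable_vallee_poussin a0)
      (integrable_vallee_poussin s0)).
  have wC t : `|w t| <= 6.
    rewrite (le_trans (ler_normB _ _))//.
    by have := vallee_poussin_bound t a0; have := vallee_poussin_bound t s0;
      lra.
  pose W0 := \int[mu]_t `|w t|.
  have W00 : 0 <= W0 by exact: Rintegral_ge0.
  pose H n := \int[mu]_t (w t * modulated (truncation n f1) (truncation n f2)
    x t).
  have Hcvg : H @ \oo --> V a - V sigma.
    pose J b n := \int[mu]_y (fejer b (x - y) * truncation n f1 y).
    (* The multiplication formula turns [H n] into pairings of the truncation with Fejér kernels,
       whose limits are known. *)
    have -> : H = (fun n => (2 * J (2 * a) n - J a n) - (2 * J (2 * sigma)
      n - J sigma n)).
      apply/funext => n; have i1 := integrable_truncation n F1;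
        have i2 := integrable_truncation n F2.
      rewrite /J -!(vallee_poussin_multiplication x _ i1 i2)// -RintegralB//.
      - by apply: eq_Rintegral => t _; rewrite /w mulrBl.
      - exact: integrable_vallee_poussin_modulated.
      - exact: integrable_vallee_poussin_modulated.
    have Jcvg b : 0 < b -> J b @ \oo --> T b by move=> b0;
      exact: truncation_pairing_cvg.
    by apply: cvgB; apply: cvgB; rewrite ?mulr_gt0//;
      [apply: cvgMr|apply: Jcvg|apply: cvgMr|apply: Jcvg];
      rewrite ?mulr_gt0//; apply: Jcvg; rewrite mulr_gt0.
  suff : V a - V sigma = 0 by move/eqP; rewrite subr_eq0 => /eqP.
  apply/eqP; rewrite -normr_le0; apply/ler_addgt0Pl => e0 e00.
  rewrite addr0.
  (* The total error is [e] for replacing the limit by [H n], plus [e * W0 + 6 * e] for [H n]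
     itself, where 6 bounds [|w|]. *)
  pose K := W0 + 7; have K0 : 0 < K by rewrite ltr_wpDl.
  have [e e_0 eK] : exists2 e, 0 < e & e0 = e * K.
    by exists (e0 / K); [rewrite divr_gt0|rewrite divfK// gt_eqF].
  have [n [Hn Dn]] : exists n, `|V a - V sigma - H n| <= e /\
     (\int[mu]_t (spectral_error f1 f2 g1 g2 n t)%:E <= (e ^+ 2)%:E)%E.
    move/cvgrPdist_le : Hcvg => /(_ _ e_0) h1.
    move/fine_cvgP : Fg => [h2 /cvgrPdist_le /(_ _ (exprn_gt0 2 e_0)) h3].
    near \oo => n; exists n; split; first by near: n.
    have n2 : (\int[mu]_t (spectral_error f1 f2 g1 g2 n t)%:E \is a fin_num)%E
      by near: n.
    rewrite -(fineK n2) lee_fin (le_trans (ler_norm _))//.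
    have : `|0 - fine (\int[mu]_t (spectral_error f1 f2 g1 g2 n t)%:E)%E| <= e
      ^+ 2 by near: n.
    by rewrite sub0r normrN.
  have i1 := integrable_truncation n F1; have i2 := integrable_truncation n F2.
  have mP := measurable_fourier_re i1 i2.
  have mQ := measurable_fourier_re i2 (integrableN i1).
  have Hb : `|H n| <= e * W0 + 6 * e.
    have := @Rintegral_product_bound w (modulated (truncation n f1)
      (truncation n f2) x)
     (spectral_error f1 f2 g1 g2 n) 6 e e_0 _ iw wC
       (measurable_modulated x i1 i2).
    move=> h; rewrite -lee_fin.
    apply: (le_trans (h _ _ _ _)) => //.
    - apply: measurable_funD; apply: measurable_funX; exact: measurable_funB.
    - by move=> t; rewrite addr_ge0// sqr_ge0.
    - apply: (@filterS _ _ ae_lebesgue_filter _ _ _ g0) => t {}g0 wt.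
      have st : sigma < `|t|.
        rewrite ltNge; apply/negP => ts; move/eqP: wt; apply.
        by rewrite /w !vallee_poussin_eq1// ?subrr// (le_trans ts).
      (* Where [g] vanishes, the square of the real part of a rotated complex number is at most its
         squared modulus; the defect is again a square. *)
      rewrite /spectral_error; have [-> ->] := g0 st; rewrite !subr0 /modulated.
      have := cos2Dsin2 (t * x).
      move: (cos _) (sin _) (fourier_re _ _ _) (fourier_re _ _ _) => p q P Q pq.
      rewrite -[leRHS]mul1r -pq -subr_ge0.
      by rewrite (_ : _ - _ = (p * P + q * Q) ^+ 2) ?sqr_ge0//; ring.
    rewrite [leRHS]EFinD EFinM leeD2l// (le_trans (lee_wpmul2l _ Dn))
      ?lee_fin ?divr_ge0 ?(ltW e_0)//.
    by rewrite expr2 mulrA divfK// gt_eqF.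
  have -> : V a - V sigma = (V a - V sigma - H n) + H n by ring.
  rewrite (le_trans (ler_normD _ _))// (le_trans (lerD Hn Hb))//.
  by rewrite eK /K le_eqVlt; apply/orP; left; apply/eqP; ring.
have VE : V sigma = \int[mu]_y (vallee_poussin_kernel sigma (x - y) * f1 y).
  have s20 : 0 < 2 * sigma by rewrite mulr_gt0.
  have j1 := integrable_fejer_pairing x s0 F1.
  have j2 := integrable_fejer_pairing x s20 F1.
  rewrite /V /T -RintegralZl// -RintegralB//;
    last exact: (integrableZl measurableT 2 j2).
  by apply: eq_Rintegral => y _; rewrite /vallee_poussin_kernel; ring.
rewrite -VE; apply/eqP; rewrite -subr_eq0 -normr_le0;
  apply/ler_addgt0Pl => e0 e00.
rewrite addr0 distrC.
(* [V a] combines [T (2 * a)] and [T a] with weights 2 and -1: the limit is [2c - c = c] times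
   [f1 x], and the errors add up to 3 times [e * (c + 1)]. *)
pose e := e0 / (3 * (c + 1)).
have c1 : 0 < 3 * (c + 1) by rewrite mulr_gt0// ltr_wpDr// ltW.
have e_0 : 0 < e by rewrite divr_gt0.
have [a0 a00 aE] := fejer_approximate_identity (fun a => cE a x) F1 cf e_0.
pose a := Num.max a0 sigma.
have aa0 : a0 <= a by rewrite le_max lexx.
have sa : sigma <= a by rewrite le_max lexx orbT.
rewrite -(Vconst a sa).
have h1 := aE a aa0.
have h2 : `|T (2 * a) - c * f1 x| <= e * (c + 1).
  apply: aE; apply: (le_trans aa0);
    rewrite ler_peMl ?ler1n// (le_trans _ sa)// ltW//.
have -> : V a - c * f1 x = 2 * (T (2 * a) - c * f1 x) - (T a - c * f1 x)
  by rewrite /V; ring.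
rewrite (le_trans (ler_normB _ _))// normrM (ger0_norm (_ : 0 <= 2))//.
have -> : e0 = 2 * (e * (c + 1)) + e * (c + 1).
  by rewrite /e; field; rewrite gt_eqF// ltr_wpDr// ltW.
by rewrite lerD// ler_wpM2l.
Unshelve. all: by end_near.
Qed.

End Reproducing.

(** * Passage from complex-valued functions to real and imaginary parts *)

Section ComplexValued.
Context {R : realType}.
Local Notation mu := (@lebesgue_measure R).
Local Notation rT := (measurableTypeR R).

Lemma ReB (z w : R[i]) : complex.Re (z - w) = complex.Re z - complex.Re w.
Proof. by case: z w => a b []. Qed.

Lemma ImB (z w : R[i]) : complex.Im (z - w) = complex.Im z - complex.Im w.
Proof. by case: z w => a b []. Qed.

Lemma cabs_sqr (z : R[i]) : cabs z ^+ 2 = complex.Re z ^+ 2 + complex.Im z ^+ 2.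
Proof. by case: z => a b; rewrite /cabs /= sqr_sqrtr// addr_ge0// sqr_ge0. Qed.

Lemma cabs_ge0 (z : R[i]) : 0 <= cabs z.
Proof. by case: z => a b; rewrite /cabs /= sqrtr_ge0. Qed.

Lemma cabsM (z w : R[i]) : cabs (z * w) = cabs z * cabs w.
Proof. exact: ComplexField.Normc.normcM. Qed.

Lemma norm_Re_le_cabs (z : R[i]) : `|complex.Re z| <= cabs z.
Proof.
rewrite -(ler_pXn2r (n := 2))// ?nnegrE ?cabs_ge0//.
by rewrite real_normK ?num_real// cabs_sqr lerDl sqr_ge0.
Qed.

Lemma norm_Im_le_cabs (z : R[i]) : `|complex.Im z| <= cabs z.
Proof.
rewrite -(ler_pXn2r (n := 2))// ?nnegrE ?cabs_ge0//.
by rewrite real_normK ?num_real// cabs_sqr lerDr sqr_ge0.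
Qed.

Lemma cnormE (z : R[i]) : `|z| = (cabs z)%:C.
Proof. by case: z. Qed.

Lemma cvg_complexP (T : Type) (F : set_system T) (FF : Filter F)
    (f : T -> R[i]^o) (l : R[i]^o) :
  f @ F --> l ->
  (fun t => complex.Re (f t)) @ F --> complex.Re l /\
  (fun t => complex.Im (f t)) @ F --> complex.Im l.
Proof.
move=> fl0; have fl := (@cvgrPdist_le _ _ _ _ FF f l).1 fl0; split;
  apply/cvgrPdist_le => e e0.
- have e0C : 0 < e%:C :> R[i] by rewrite ltcR.
  move: (fl _ e0C); apply: filterS => t.
  rewrite cnormE lecR; apply: le_trans.
  by rewrite (le_trans _ (norm_Re_le_cabs _))//; case: (f t) (l) => a b [].
- have e0C : 0 < e%:C :> R[i] by rewrite ltcR.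
  move: (fl _ e0C); apply: filterS => t.
  rewrite cnormE lecR; apply: le_trans.
  by rewrite (le_trans _ (norm_Im_le_cabs _))//; case: (f t) (l) => a b [].
Qed.

Lemma measurable_cabs (f : R -> R[i]) : cmeasurable f ->
  measurable_fun [set: R] (fun x => cabs (f x)).
Proof.
move=> [m1 m2]; rewrite (_ : (fun x => _) =
  (fun x => Num.sqrt (complex.Re (f x) ^+ 2 + complex.Im (f x) ^+ 2)));
    last first.
  by apply/funext => x; rewrite -cabs_sqr sqrtr_sqr ger0_norm// cabs_ge0.
apply: measurableT_comp; first by apply: continuous_measurable_fun;
  exact: sqrt_continuous.
by apply: measurable_funD; exact: measurable_funX.
Qed.

Lemma cLnorm2_sqr (f : R -> R[i]) :
  (cLnorm 2%:E f ^+ 2 = \int[mu]_x (cabs (f x) ^+ 2)%:E)%E.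
Proof. exact: (Lnorm2_sqr (fun x => cabs (f x))). Qed.

Lemma L2_square_integrable (f : R -> R[i]) : L2 f ->
  square_integrable (fun x => complex.Re (f x)) /\
  square_integrable (fun x => complex.Im (f x)).
Proof.
move=> [mf foo].
have mc := measurable_cabs mf.
have coo : (\int[mu]_x (cabs (f x) ^+ 2)%:E < +oo)%E.
  rewrite -cLnorm2_sqr; have : (0 <= cLnorm 2%:E f)%E by exact: Lnorm_ge0.
  by move: foo; case: (cLnorm _ _) => // r _ _; rewrite -EFin_expe ltry.
split; (split; first by case: mf); apply: le_lt_trans coo;
  apply: ge0_le_integral => //.
- by move=> x _; rewrite lee_fin sqr_ge0.
- by apply/measurable_EFinP; apply: measurable_funX; case: mf.
- by apply/measurable_EFinP; exact: measurable_funX.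
- by move=> x _; rewrite lee_fin cabs_sqr lerDl sqr_ge0.
- by move=> x _; rewrite lee_fin sqr_ge0.
- by apply/measurable_EFinP; apply: measurable_funX; case: mf.
- by apply/measurable_EFinP; exact: measurable_funX.
- by move=> x _; rewrite lee_fin cabs_sqr lerDr sqr_ge0.
Qed.

(* The points outside the support are covered by countably many intervals with
   rational endpoints on which g vanishes almost everywhere. *)
Lemma ae_support_eq0 (g : R -> R[i]) (sigma : R) :
  ae_support g `<=` `[- sigma, sigma] ->
  {ae mu, forall t, sigma < `|t| -> g t = 0}.
Proof.
move=> gs.
pose ball2 (r : rat * rat) : set R := `]ratr r.1, ratr r.2[%classic.
pose bad (r : rat * rat) : set rT := [set t | ball2 r t /\ g t <> 0].
(* Integers coding no pair of rationals, and intervals whose exceptional set is not negligible,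
   contribute the empty set, so every [F n] is negligible. *)
pose F (n : nat) : set rT :=
  if unpickle n is Some r then (if `[< mu.-negligible (bad r) >]
    then bad r else set0) else set0.
have nF : mu.-negligible (\bigcup_n F n).
  apply: negligible_bigcup => n; rewrite /F.
  case: unpickle => [r|]; last exact: negligible_set0.
  by case: asboolP => // _; exact: negligible_set0.
apply: negligibleS nF => t /= gt.
have [st gt0] : sigma < `|t| /\ g t <> 0.
  by apply/not_implyP.
have : ~ ae_support g t.
  by move=> /gs /=; rewrite in_itv/= -ler_norml leNgt st.
move=> /contrapT[U Ut gU].
move: Ut => /nbhs_ballP[e /= e0 eU].
have [p] := @rat_in_itvoo R (t - e) t (ltac:(lra));
  rewrite in_itv/= => /andP[p1 p2].
have [q] := @rat_in_itvoo R t (t + e) (ltac:(lra));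
  rewrite in_itv/= => /andP[q1 q2].
have bn : mu.-negligible (bad (p, q)).
  apply: negligibleS gU => s /= [+ gs0] Us;
    rewrite /ball2/= in_itv/= => /andP[s1 s2].
  apply: gs0; apply: Us; apply: eU; rewrite /ball/= ltr_norml; apply/andP;
    split; lra.
exists (pickle (p, q)); first exact: I.
rewrite /F pickleK asboolT//; split => //=; rewrite /ball2/= in_itv/=;
  apply/andP; split => //.
Qed.

Lemma Re_fourier_truncation (f : R -> R[i]) n t :
  complex.Re (fourier (fun x => if x \in `[- n%:R, n%:R] then f x else 0) t) =
  fourier_re (truncation n (fun x => complex.Re (f x)))
    (truncation n (fun x => complex.Im (f x))) t.
Proof.
apply: eq_Rintegral => x _; rewrite /truncation; case: ifPn => _.
  by case: (f x) => a b /=; rewrite cosN sinN; ring.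
by rewrite !mulr0 addr0.
Qed.

Lemma Im_fourier_truncation (f : R -> R[i]) n t :
  complex.Im (fourier (fun x => if x \in `[- n%:R, n%:R] then f x else 0) t) =
  fourier_re (truncation n (fun x => complex.Im (f x)))
    (\- truncation n (fun x => complex.Re (f x))) t.
Proof.
apply: eq_Rintegral => x _; rewrite /truncation /=; case: ifPn => _.
  by case: (f x) => a b /=; rewrite cosN sinN; ring.
by rewrite !mulr0 oppr0 mulr0 addr0.
Qed.

End ComplexValued.

(** * Pointwise bounds for Paley-Wiener functions *)

Section PaleyWiener.
Context {R : realType}.
Local Notation mu := (@lebesgue_measure R).
Local Notation rT := (measurableTypeR R).

Lemma truncationN n (f : R -> R) : truncation n (\- f) = \- truncation n f.
Proof. by apply/funext => x; rewrite /truncation/=; case: ifP;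
  rewrite ?oppr0. Qed.

Lemma fourier_reN (f1 f2 : R -> R) t :
  mu.-integrable [set: R] (EFin \o f1) ->
  mu.-integrable [set: R] (EFin \o f2) ->
  fourier_re (\- f1) (\- f2) t = - fourier_re f1 f2 t.
Proof.
move=> i1 i2; have it := integrable_fourier_re t i1 i2.
rewrite -mulN1r -RintegralZl//.
by apply: eq_Rintegral => y _ /=; ring.
Qed.

Lemma square_integrableN (f : R -> R) : square_integrable f ->
  square_integrable (\- f).
Proof.
move=> [mf foo]; split; first exact: measurable_funN.
by under eq_integral do rewrite /= sqrrN.
Qed.

(** The imaginary part of [f] is the real part of [-i f = f2 - i f1], whose transform is
    [-i g = g2 - i g1], so the real formula is applied twice. *)
Lemma PW_reproducing (sigma c : R) (f : R -> R[i]) (x : R) :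
  0 < sigma -> 0 < c ->
  (forall a x, 0 < a -> (\int[mu]_y (fejer a (x - y))%:E = c%:E)%E) ->
  PW sigma f ->
  c * complex.Re (f x) =
    \int[mu]_y (vallee_poussin_kernel sigma (x - y) * complex.Re (f y)) /\
  c * complex.Im (f x) =
    \int[mu]_y (vallee_poussin_kernel sigma (x - y) * complex.Im (f y)).
Proof.
move=> s0 c0 cE [cf [g [fL2 gL2 Fg] gs]].
have [F1 F2] := L2_square_integrable fL2.
have [G1 G2] := L2_square_integrable gL2.
have [cf1 cf2] := cvg_complexP _ (cf x).
pose f1 y := complex.Re (f y); pose f2 y := complex.Im (f y).
pose g1 y := complex.Re (g y); pose g2 y := complex.Im (g y).
have g0 : {ae mu, forall t, sigma < `|t| -> g1 t = 0 /\ g2 t = 0}.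
  apply: (@filterS _ _ ae_lebesgue_filter _ _ _ (ae_support_eq0 gs)) => t gt st.
  by rewrite /g1 /g2 gt.
(* These integrals are the squares of the [L^2] norms in the definition of the Fourier transform. *)
have D0 : (fun n => \int[mu]_t (spectral_error f1 f2 g1 g2 n t)%:E)%E @ \oo
    --> 0%E.
  pose N n := cLnorm 2%:E
    (fourier (fun x => if x \in `[- n%:R, n%:R] then f x else 0) \- g).
  rewrite (_ : (fun n : nat => _) = (fun n => (N n * N n)%E)); last first.
    apply/funext => n; rewrite -expe2 cLnorm2_sqr; apply: eq_integral => t _.
    rewrite cabs_sqr /spectral_error -Re_fourier_truncation
      -Im_fourier_truncation.
    by rewrite ReB ImB.
  rewrite -[X in _ --> X](mule0 0%E).
  exact: (cvgeM (mule_def_fin (isT : 0%:E \is a fin_num)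
    (isT : 0%:E \is a fin_num)) Fg Fg).
split.
- exact: (reproducing_formula s0 c0 cE F1 F2 cf1 G1.1 G2.1 g0 D0).
- have nF1 := square_integrableN F1.
  apply: (reproducing_formula (f2 := \- f1) (g1 := g2) (g2 := \- g1)
    s0 c0 cE F2 nF1 cf2 G2.1).
  + exact: measurable_funN G1.1.
  + apply: (@filterS _ _ ae_lebesgue_filter _ _ _ g0) => t g0t st.
    by have [h1 h2] := g0t st; rewrite /= h1 h2 oppr0.
  (* Multiplication by [-i] leaves the squared modulus of the error unchanged. *)
  + rewrite (_ : (fun n : nat => _) = (fun n =>
    \int[mu]_t (spectral_error f1 f2 g1 g2 n t)%:E)%E)//.
    apply/funext => n; apply: eq_integral => t _; congr (_%:E).
    have i1 := integrable_truncation n F1;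
      have i2 := integrable_truncation n F2.
    rewrite /spectral_error truncationN fourier_reN//=; ring.
Qed.

Lemma vallee_poussin_kernel_le (sigma : R) : 0 < sigma ->
  exists2 A : R, 0 <= A &
    forall z, `|vallee_poussin_kernel sigma z| <= A * (oneDsqr z)^-1.
Proof.
move=> s0; have s20 : 0 < 2 * sigma by rewrite mulr_gt0.
have [A A0 Ale] := fejer_le_cauchy s0; have [B B0 Ble] := fejer_le_cauchy s20.
exists (2 * B + A); first by rewrite addr_ge0// mulr_ge0.
move=> z; rewrite (le_trans (ler_normB _ _))// normrM !ger0_norm ?fejer_ge0//.
by rewrite [leRHS]mulrDl -mulrA lerD// ler_wpM2l.
Qed.

Lemma measurable_cauchy_shift x :
  measurable_fun [set: R] (fun y : R => (oneDsqr (x - y))^-1).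
Proof.
by apply: (measurableT_comp measurable_cauchy); exact: measurable_funB.
Qed.

(** The kernel is replaced by its Cauchy majorant, which then serves as the weight in
    Cauchy-Schwarz; by reflection the mass of the weight does not depend on [x]. *)
Lemma reproduced_sqr_le (k f : R -> R) (A x v : R) : 0 <= A ->
  measurable_fun [set: R] k -> (forall z, `|k z| <= A * (oneDsqr z)^-1) ->
  square_integrable f -> v = \int[mu]_y (k (x - y) * f y) ->
  ((v ^+ 2)%:E <= (A ^+ 2 * \int[mu]_y (oneDsqr y)^-1)%:E *
     \int[mu]_y ((oneDsqr (x - y))^-1 * f y ^+ 2)%:E)%E.
Proof.
move=> A0 mk kA f2 vE; have ikf := integrable_pairing x A0 mk kA f2.
have mw := measurable_cauchy_shift x.
have mwf : measurable_fun [set: R] (fun y =>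
  ((oneDsqr (x - y))^-1 * `|f y|)%:E).
  by apply/measurable_EFinP; apply: measurable_funM => //;
    apply: measurableT_comp => //; exact: f2.1.
have Q0 : (0 <= \int[mu]_y ((oneDsqr (x - y))^-1 * `|f y|)%:E)%E.
  by apply: integral_ge0 => y _; rewrite lee_fin mulr_ge0// oneDsqr_inv_ge0.
have h : (`|v|%:E <= A%:E * \int[mu]_y ((oneDsqr (x - y))^-1 * `|f y|)%:E)%E.
  rewrite vE -abse_EFin EFin_Rintegral//.
  apply: le_trans (le_abse_integral _ _ _) _ => //;
    first exact: measurable_int ikf.
  rewrite -ge0_integralZl_EFin//.
  apply: ge0_le_integral => //.
  - by apply: measurableT_comp => //; exact: measurable_int ikf.
  - exact: measurable_funeM.
  - by move=> y _ /=; rewrite -EFinM lee_fin normrM mulrA ler_wpM2r.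
have -> : ((v ^+ 2)%:E = `|v|%:E ^+ 2)%E by rewrite -EFin_expe real_normK//
  num_real.
rewrite -lee_sqr in h; last 2 first.
- by rewrite lee_fin.
- by rewrite mule_ge0// lee_fin.
apply: (le_trans h); rewrite expe2 muleACA -!expe2 EFinM -EFin_expe -muleA.
rewrite lee_wpmul2l ?lee_fin ?sqr_ge0//.
have := weighted_cauchy_schwarz mw f2.1 (fun y => oneDsqr_inv_ge0 _).
rewrite EFin_Rintegral; last exact: integrable_cauchy.
rewrite (@ge0_integral_reflect R (fun y => ((oneDsqr y)^-1)%:E))//.
by apply/measurable_EFinP; exact: measurable_cauchy.
Qed.

Lemma PW_sqr_le (sigma : R) : 0 < sigma ->
  exists2 A : R, 0 <= A & forall f : R -> R[i], PW sigma f -> forall x,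
    ((cabs (f x) ^+ 2)%:E <=
     A%:E * \int[mu]_y ((oneDsqr (x - y))^-1 * cabs (f y) ^+ 2)%:E)%E.
Proof.
move=> s0; have [c c0 cE] := fejer_mass (R := R).
have [A A0 kA] := vallee_poussin_kernel_le s0.
have mk : measurable_fun [set: R] (vallee_poussin_kernel sigma).
  by apply: measurable_funB; [apply: measurable_funM => //;
    exact: measurable_fejer|exact: measurable_fejer].
pose W := \int[mu]_y (oneDsqr y)^-1.
have W0 : 0 <= W by apply: Rintegral_ge0 => y _; exact: oneDsqr_inv_ge0.
(* The division by [c ^+ 2] undoes the factor [c] in the reproducing formula. *)
exists (A ^+ 2 * W / c ^+ 2);
  first by rewrite divr_ge0 ?sqr_ge0 ?mulr_ge0 ?sqr_ge0.
move=> f fPW x; have [E1 E2] := PW_reproducing x s0 c0 cE fPW.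
have [cf [g [fL2 _ _] _]] := fPW.
have [F1 F2] := L2_square_integrable fL2.
have h1 := reproduced_sqr_le A0 mk kA F1 E1.
have h2 := reproduced_sqr_le A0 mk kA F2 E2.
have := leeD h1 h2; rewrite -ge0_muleDr; last 2 first.
- by apply: integral_ge0 => y _;
  rewrite lee_fin mulr_ge0 ?oneDsqr_inv_ge0 ?sqr_ge0.
- by apply: integral_ge0 => y _;
  rewrite lee_fin mulr_ge0 ?oneDsqr_inv_ge0 ?sqr_ge0.
rewrite -ge0_integralD//; last 4 first.
- by move=> y _; rewrite lee_fin mulr_ge0 ?oneDsqr_inv_ge0 ?sqr_ge0.
- by apply/measurable_EFinP; apply: measurable_funM;
  [exact: measurable_cauchy_shift|exact: measurable_funX F1.1].
- by move=> y _; rewrite lee_fin mulr_ge0 ?oneDsqr_inv_ge0 ?sqr_ge0.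
- by apply/measurable_EFinP; apply: measurable_funM;
  [exact: measurable_cauchy_shift|exact: measurable_funX F2.1].
rewrite (eq_integral (fun y : rT =>
  ((oneDsqr (x - y))^-1 * cabs (f y) ^+ 2)%:E)); last first.
  by move=> y _; rewrite -EFinD -mulrDr cabs_sqr.
rewrite -EFinD !exprMn -mulrDr -cabs_sqr => h.
have c20 : c ^+ 2 != 0 by rewrite gt_eqF// exprn_gt0.
rewrite -(mulKf c20 (cabs (f x) ^+ 2))
  EFinM [A ^+ 2 * W / _]mulrC [X in (_ <= X * _)%E]EFinM -muleA.
by rewrite lee_wpmul2l ?lee_fin ?invr_ge0 ?sqr_ge0//; apply: h.
Qed.

End PaleyWiener.

(** * Sums over separated sets, first of [f], then of its convolutions *)

Section Sampling.
Context {R : realType}.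
Local Notation mu := (@lebesgue_measure R).
Local Notation rT := (measurableTypeR R).

Definition spaced (d : R) (S : set R) :=
  forall x y, S x -> S y -> x != y -> d <= `|x - y|.

Lemma uniformly_discrete_spaced (S : set R) : uniformly_discrete S ->
  exists2 d : R, 0 < d & spaced d S.
Proof.
rewrite /uniformly_discrete; set i := ereal_inf _ => i0.
have Si x y : S x -> S y -> x != y -> (i <= (`|x - y|)%:E)%E.
  by move=> Sx Sy xy; apply: ereal_inf_lbound; exists x, y; split.
case: i i0 Si => [d| |]//.
- by rewrite lte_fin => d0 Si; exists d => // x y Sx Sy xy; rewrite -lee_fin Si.
(* The infimum is [+oo] only when no two points are distinct; any spacing then works. *)
- move=> _ Si; exists 1 => // x y Sx Sy xy.
  by have := Si _ _ Sx Sy xy; rewrite leye_eq.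
Qed.

(** The intervals are pairwise disjoint; they are half-open because two centres may be at distance
    exactly [d]. *)
Lemma sum_indicator_le1 (d : R) (s : seq R) (t : R) : uniq s ->
  spaced d [set` s] ->
  \sum_(l <- s) (\1_(`[l - d / 2, l + d / 2[%classic : set R) t : R) <= 1.
Proof.
elim: s => [|a s IH] /=; first by rewrite big_nil.
move=> /andP[as_ us] sep; rewrite big_cons.
have sep' : spaced d [set` s].
  by move=> x y /= xs ys; apply: sep => /=; rewrite inE ?xs ?ys orbT.
have [ta|ta] := boolP (t \in (`[a - d / 2, a + d / 2[%classic : set R));
  last first.
  by rewrite indicE (negbTE ta) add0r IH.
rewrite indicE ta big1_seq ?addr0// => l /= ls.
rewrite indicE memNset// => /=; rewrite in_itv/= => /andP[l1 l2].
have la : l != a by apply: contraNneq as_ => <-.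
have : d <= `|l - a|.
  by apply: sep => //=; rewrite inE ?eqxx ?ls ?orbT.
move: ta; rewrite inE/= in_itv/= => /andP[a1 a2].
by rewrite leNgt ltr_norml => /negP; apply; apply/andP; split; lra.
Qed.

(** From [(y - t)^2 <= 2 (l - y)^2 + 2 (t - l)^2] and [(t - l)^2 <= d^2 / 4]. *)
Lemma cauchy_local (d l t y : R) : `|t - l| <= d / 2 ->
  (oneDsqr (l - y))^-1 <= (2 + d ^+ 2 / 2) * (oneDsqr (y - t))^-1.
Proof.
move=> tl.
have w1 : 0 < oneDsqr (l - y) by rewrite ltr_pwDl// sqr_ge0.
have w2 : 0 < oneDsqr (y - t) by rewrite ltr_pwDl// sqr_ge0.
rewrite ler_pdivlMr// mulrC ler_pdivrMr// /oneDsqr.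
have : (t - l) ^+ 2 <= (d / 2) ^+ 2.
  by rewrite -(real_normK (num_real (t - l))) lerXn2r ?nnegrE// (le_trans _ tl).
move: (sqr_ge0 ((t - l) - (l - y))) (sqr_ge0 (d * (l - y))) => h1 h2 h3.
nra.
Qed.

(* The kernel at l is comparable to its mean over the interval of length d
   around l, and these intervals are disjoint. *)
Lemma sum_cauchy_le (d : R) : 0 < d -> exists2 C : R, 0 <= C &
  forall (s : seq R) (y : R), uniq s -> spaced d [set` s] ->
    \sum_(l <- s) (oneDsqr (l - y))^-1 <= C.
Proof.
move=> d0; pose M := 2 + d ^+ 2 / 2.
have M0 : 0 <= M by rewrite addr_ge0// divr_ge0// sqr_ge0.
pose W := \int[mu]_y (oneDsqr y)^-1.
have W0 : 0 <= W by apply: Rintegral_ge0 => y _; exact: oneDsqr_inv_ge0.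
exists (M * W / d); first by rewrite divr_ge0 ?(ltW d0)// mulr_ge0.
move=> s y us sep; rewrite ler_pdivlMr// mulr_suml.
pose J (l : R) : set rT := `[l - d / 2, l + d / 2[%classic.
have mJ l : measurable (J l) by exact: measurable_itv.
have iJ l : (\int[mu]_t ((oneDsqr (l - y))^-1 * \1_(J l)
  t)%:E = ((oneDsqr (l - y))^-1 * d)%:E)%E.
  under eq_integral do rewrite EFinM.
  rewrite ge0_integralZl_EFin ?oneDsqr_inv_ge0//; last first.
    by apply/measurable_EFinP; apply: measurable_indic; exact: mJ.
  have -> : (\int[mu]_t (\1_(J l)
    t)%:E = mu (J l))%E by rewrite integral_indic// setIT.
  have -> : mu (J l) = d%:E.
    rewrite /J lebesgue_measure_itv/= lte_fin ifT; last by lra.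
    by rewrite -EFinB; congr (_%:E); lra.
  by rewrite EFinM.
have mWy : measurable_fun [set: R] (fun t : R =>
  (oneDsqr (y - t))^-1) by exact: measurable_cauchy_shift.
have mi l : measurable_fun [set: R] (\1_(J l) : R ->
  R) by apply: measurable_indic; exact: mJ.
rewrite -lee_fin -sumEFin.
under eq_bigr do rewrite -iJ.
rewrite -ge0_integral_sum//; last first.
  by move=> l; apply/measurable_EFinP; exact: measurable_funM.
have WE : (\int[mu]_t (M * (oneDsqr (y - t))^-1)%:E = (M * W)%:E)%E.
  under eq_integral do rewrite EFinM.
  rewrite ge0_integralZl_EFin//; last exact/measurable_EFinP.
  rewrite (@ge0_integral_reflect R (fun t => ((oneDsqr t)^-1)%:E))//;
    last first.
    by apply/measurable_EFinP; exact: measurable_cauchy.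
  by rewrite -EFin_Rintegral ?EFinM//; exact: integrable_cauchy.
rewrite -WE; apply: ge0_le_integral => //.
- by move=> t _; apply: sume_ge0 => l _;
  rewrite lee_fin mulr_ge0 ?oneDsqr_inv_ge0.
- by apply: emeasurable_sum => l; apply/measurable_EFinP;
  exact: measurable_funM.
- by apply/measurable_EFinP; exact: measurable_funM.
- move=> t _; rewrite sumEFin lee_fin.
  apply: (@le_trans _ _ (\sum_(l <- s) (M * (oneDsqr (y - t))^-1 * \1_(J l)
    t))).
    apply: ler_sum => l _; rewrite indicE; case: (boolP (t \in J l)) => [|_];
      last by rewrite !mulr0.
    rewrite inE /J/= in_itv/= => /andP[t1 t2]; rewrite !mulr1.
    by apply: cauchy_local; rewrite ler_norml; apply/andP; split; lra.
  rewrite -mulr_sumr ler_piMr//; first by rewrite mulr_ge0// oneDsqr_inv_ge0.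
  exact: sum_indicator_le1.
Qed.

(** Cauchy-Schwarz with weight [|phi (l - s)|]. Real and imaginary parts are each bounded by the
    integral of the modulus, whence the factor 2. *)
Lemma convolution_sqr_le (f phi : R -> R[i]) (l : R) :
  cmeasurable f -> cmeasurable phi ->
  ((cabs (convolution f phi l) ^+ 2)%:E <=
   2%:E * ((\int[mu]_s (cabs (phi s))%:E) *
      \int[mu]_s (cabs (phi s) * cabs (f (l - s)) ^+ 2)%:E))%E.
Proof.
move=> mf mphi.
have mcf := measurable_cabs mf.
have mcp := measurable_cabs mphi.
have msub : measurable_fun [set: R] (fun s : R =>
  l - s) by exact: measurable_funB.
have mp : measurable_fun [set: R] (fun s => cabs (phi (l - s))).
  exact: (measurableT_comp mcp msub).
pose H := (\int[mu]_s (cabs (phi (l - s)) * `|cabs (f s)|)%:E)%E.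
have H0 : (0 <= H)%E.
  by apply: integral_ge0 => s _; rewrite lee_fin mulr_ge0// cabs_ge0.
have key (g : R -> R) : measurable_fun [set: R] g ->
    (forall s, `|g s| <= cabs (phi (l - s) * f s)) ->
    (((\int[mu]_s g s) ^+ 2)%:E <= H ^+ 2)%E.
  move=> mg gle.
  have -> : (((\int[mu]_s g s)%R ^+ 2)%:E = `|(\int[mu]_s g s)%R|%:E ^+ 2)%E.
    by rewrite -EFin_expe real_normK// num_real.
  rewrite lee_sqr//.
  apply: (@le_trans _ _ `|\int[mu]_s (g s)%:E|%E).
    (* An infinite integral becomes 0 as a real number, which respects the bound. *)
    by rewrite /Rintegral; case: (\int[mu]_s _)%E => [r||] //=;
      rewrite normr0 leey.
  apply: le_trans (le_abse_integral _ _ _) _ => //;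
    first exact/measurable_EFinP.
  apply: ge0_le_integral => //.
  - by apply: measurableT_comp => //; exact/measurable_EFinP.
  - by apply/measurable_EFinP; apply: measurable_funM => //;
    exact: measurableT_comp.
  - by move=> s _; rewrite lee_fin (le_trans (gle s))// cabsM (ger0_norm
    (cabs_ge0 _)).
have mphi1 : measurable_fun [set: R] (fun s => complex.Re (phi (l - s))).
  exact: (measurableT_comp mphi.1 msub).
have mphi2 : measurable_fun [set: R] (fun s => complex.Im (phi (l - s))).
  exact: (measurableT_comp mphi.2 msub).
have k1 : (((\int[mu]_s complex.Re (phi (l - s) * f s)) ^+ 2)%:E <= H ^+ 2)%E.
  apply: key => [|s]; last exact: norm_Re_le_cabs.
  rewrite (_ : (fun s => _) = (fun s =>
    complex.Re (phi (l - s)) * complex.Re (f s) -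
     complex.Im (phi (l - s)) * complex.Im (f s))); last first.
    by apply/funext => s; case: (phi _) (f _) => a b [].
  by apply: measurable_funB; apply: measurable_funM => //;
    [exact: mf.1|exact: mf.2].
have k2 : (((\int[mu]_s complex.Im (phi (l - s) * f s)) ^+ 2)%:E <= H ^+ 2)%E.
  apply: key => [|s]; last exact: norm_Im_le_cabs.
  rewrite (_ : (fun s => _) = (fun s =>
    complex.Re (phi (l - s)) * complex.Im (f s) +
     complex.Im (phi (l - s)) * complex.Re (f s))); last first.
    by apply/funext => s; case: (phi _) (f _) => a b [].
  by apply: measurable_funD; apply: measurable_funM => //;
    [exact: mf.2|exact: mf.1].
rewrite cabs_sqr /convolution /cintegral EFinD.
apply: (le_trans (leeD k1 k2)).
have -> : (H ^+ 2 + H ^+ 2 = 2%:E * H ^+ 2)%E.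
  by rewrite -mule2n mule_natl.
rewrite lee_wpmul2l ?lee_fin//.
apply: (le_trans (weighted_cauchy_schwarz mp mcf (fun s => cabs_ge0 _))).
rewrite (@ge0_integral_reflect R (fun s => (cabs (phi s))%:E))//; last 2 first.
- exact/measurable_EFinP.
- by move=> s; rewrite lee_fin cabs_ge0.
rewrite lee_wpmul2l//; first by apply: integral_ge0 => s _;
  rewrite lee_fin cabs_ge0.
rewrite -(@ge0_integral_reflect R (fun s =>
  (cabs (phi (l - s)) * cabs (f s) ^+ 2)%:E) l)//; last 2 first.
- by apply/measurable_EFinP; apply: measurable_funM => //;
  exact: measurable_funX.
- by move=> s; rewrite lee_fin mulr_ge0 ?cabs_ge0 ?sqr_ge0.
rewrite le_eqVlt; apply/orP; left; apply/eqP; apply: eq_integral => s _.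
by rewrite opprB addrC subrK.
Qed.

Lemma continuous_cmeasurable (f : R -> R[i]) :
  continuous (f : R -> R[i]^o) -> cmeasurable f.
Proof.
by move=> cf; split; apply: continuous_measurable_fun => x;
  have [] := cvg_complexP _ (cf x).
Qed.

(** The line of constant [u] lies in [setT * I], so joint continuity within that set restricts to
    it. This makes each [phi u] measurable. *)
Lemma continuous_kernel_section (I : set R) (phi : R -> R -> R[i]) u :
  {within setT `*` I,
    continuous ((fun xu => phi xu.2 xu.1) : R * R -> R[i]^o)} ->
  I u -> continuous (phi u : R -> R[i]^o).
Proof.
move=> /subspace_continuousP cphi Iu x.
have h := cphi (x, u) (conj Logic.I Iu).
have g : (fun y : R => (y, u)) @ x --> within (setT `*` I) (nbhs (x, u)).
  move=> A wA.
  case: wA => -[P Q] /= [Px Qu] PQ.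
  apply: filterS Px => y Py; apply: (PQ (y, u)) => //.
  by split => //; exact: nbhs_singleton.
exact: (cvg_comp _ _ g h).
Qed.

(** The pointwise bound is summed under the integral sign. Uniformity in the translation [x] holds
    because the bound on sums of Cauchy weights is uniform in the point [x + y]. *)
Lemma PW_sum_le (sigma d : R) : 0 < sigma -> 0 < d ->
  exists2 B : R, 0 <= B & forall f : R -> R[i], PW sigma f ->
    forall (s : seq R) (x : R), uniq s -> spaced d [set` s] ->
    (\sum_(l <- s) (cabs (f (l - x)) ^+ 2)%:E <=
     B%:E * \int[mu]_y (cabs (f y) ^+ 2)%:E)%E.
Proof.
move=> s0 d0; have [A A0 fA] := PW_sqr_le s0.
have [C C0 sC] := sum_cauchy_le d0.
exists (A * C); first by rewrite mulr_ge0.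
move=> f fPW s x us sep.
have mf : measurable_fun [set: R] (fun y => cabs (f y)).
  apply: measurable_cabs; apply: continuous_cmeasurable; exact: (proj1 fPW).
have mw z : measurable_fun [set: R] (fun y =>
  (oneDsqr (z - y))^-1 * cabs (f y) ^+ 2).
  by apply: measurable_funM;
    [exact: measurable_cauchy_shift|exact: measurable_funX].
apply: (@le_trans _ _ (\sum_(l <- s)
  (A%:E * \int[mu]_y ((oneDsqr (l - x - y))^-1 * cabs (f y) ^+ 2)%:E))%E).
  by apply: lee_sum => l _; exact: fA.
rewrite -ge0_sume_distrr; last first.
  by move=> l _; apply: integral_ge0 => y _;
    rewrite lee_fin mulr_ge0 ?oneDsqr_inv_ge0 ?sqr_ge0.
rewrite EFinM -muleA lee_wpmul2l ?lee_fin//.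
rewrite -ge0_integral_sum//; last 2 first.
- by move=> l; apply/measurable_EFinP; exact: mw.
- by move=> l y _; rewrite lee_fin mulr_ge0 ?oneDsqr_inv_ge0 ?sqr_ge0.
rewrite -ge0_integralZl_EFin//; last 2 first.
- by move=> y _; rewrite lee_fin sqr_ge0.
- by apply/measurable_EFinP; exact: measurable_funX.
apply: ge0_le_integral => //.
- by move=> y _; apply: sume_ge0 => l _;
  rewrite lee_fin mulr_ge0 ?oneDsqr_inv_ge0 ?sqr_ge0.
- by apply: emeasurable_sum => l; apply/measurable_EFinP; exact: mw.
- by apply: measurable_funeM; apply/measurable_EFinP; exact: measurable_funX.
move=> y _; rewrite sumEFin -EFinM lee_fin -mulr_suml ler_wpM2r ?sqr_ge0//.
under eq_bigr do rewrite -addrA -opprD.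
exact: sC.
Qed.

(** After summing under the integral over [s], [PW_sum_le] is used with translation [s]. One factor
    [K] comes from Cauchy-Schwarz, the other from integrating the remaining weight [|phi s|]. *)
Lemma convolution_sum_le (sigma d : R) : 0 < sigma -> 0 < d ->
  exists2 B : R, 0 <= B & forall (f phi : R -> R[i]) (K : R), PW sigma f ->
    cmeasurable phi -> (cLnorm 1%:E phi <= K%:E)%E ->
    forall (s : seq R), uniq s -> spaced d [set` s] ->
    (\sum_(l <- s) (cabs (convolution f phi l) ^+ 2)%:E <=
     (B * K ^+ 2)%:E * cLnorm 2%:E f ^+ 2)%E.
Proof.
move=> s0 d0; have [B B0 fB] := PW_sum_le s0 d0.
exists (2 * B); first by rewrite mulr_ge0.
move=> f phi K fPW mphi phiK s us sep.
have mf : cmeasurable f by apply: continuous_cmeasurable; exact: (proj1 fPW).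
have mcf := measurable_cabs mf; have mcp := measurable_cabs mphi.
rewrite cLnorm2_sqr; set N := (\int[mu]_y _)%E.
have N0 : (0 <= N)%E by apply: integral_ge0 => y _; rewrite lee_fin sqr_ge0.
have pK : (\int[mu]_s (cabs (phi s))%:E <= K%:E)%E.
  move: phiK; rewrite /cLnorm Lnorm1; apply: le_trans.
  rewrite le_eqVlt; apply/orP; left; apply/eqP; apply: eq_integral => y _ /=.
  by rewrite ger0_norm// cabs_ge0.
have p0 : (0 <= \int[mu]_s (cabs (phi s))%:E)%E.
  by apply: integral_ge0 => y _; rewrite lee_fin cabs_ge0.
have K0 : 0 <= K by rewrite -lee_fin (le_trans p0).
have mfl l : measurable_fun [set: R] (fun y =>
  cabs (phi y) * cabs (f (l - y)) ^+ 2).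
  apply: measurable_funM => //; apply: measurable_funX.
  by apply: (measurableT_comp mcf); exact: measurable_funB.
have F0 l y : (0 <= (cabs (phi y) * cabs (f (l - y)) ^+ 2)%:E)%E.
  by rewrite lee_fin mulr_ge0 ?cabs_ge0 ?sqr_ge0.
apply: (@le_trans _ _ (\sum_(l <- s) (2%:E * (K%:E *
      \int[mu]_s (cabs (phi s) * cabs (f (l - s)) ^+ 2)%:E)))%E).
  apply: lee_sum => l _; apply: (le_trans (convolution_sqr_le l mf mphi)).
  rewrite lee_wpmul2l ?lee_fin// lee_wpmul2r//; exact: integral_ge0.
rewrite -ge0_sume_distrr; last first.
  by move=> l _; rewrite mule_ge0 ?lee_fin//; exact: integral_ge0.
rewrite -ge0_sume_distrr; last first.
  by move=> l _; exact: integral_ge0.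
rewrite -ge0_integral_sum//; last by move=> l; apply/measurable_EFinP;
  exact: mfl.
have -> : ((2 * B * K ^+ 2)%:E * N = 2%:E * (K%:E * (B%:E * N * K%:E)))%E.
  by rewrite [(B%:E * N * _)%E]muleAC -EFinM 2!muleA -!EFinM;
    congr (_%:E * _)%E; ring.
rewrite lee_wpmul2l ?lee_fin// lee_wpmul2l ?lee_fin//.
have BN0 : (0 <= B%:E * N)%E by rewrite mule_ge0 ?lee_fin.
apply: (@le_trans _ _ (B%:E * N * \int[mu]_s (cabs (phi s))%:E)%E); last first.
  by rewrite lee_wpmul2l.
rewrite -ge0_integralZl//; last 2 first.
- exact/measurable_EFinP.
- by move=> y _; rewrite lee_fin cabs_ge0.
apply: ge0_le_integral => //.
- by move=> y _; exact: sume_ge0.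
- by apply: emeasurable_sum => l; apply/measurable_EFinP; exact: mfl.
- by apply: measurable_funeM; exact/measurable_EFinP.
move=> y _; under eq_bigr do rewrite EFinM.
rewrite -ge0_sume_distrr; last by move=> l _; rewrite lee_fin sqr_ge0.
by rewrite muleC lee_wpmul2r ?lee_fin ?cabs_ge0//; exact: fB.
Qed.

Lemma bounded_set_measure_lty (I : set R) : is_interval I -> bounded_set I ->
  (mu I < +oo)%E.
Proof.
move=> iI [M [_ /(_ (M + 1))]].
move=> /(_ (ltac:(rewrite ltrDl//))) IM.
apply: (@le_lt_trans _ _ (mu (`[- (M + 1), M + 1]%classic : set rT))).
  apply: le_measure; rewrite ?inE.
  - exact: is_interval_measurable.
  - exact: measurable_itv.
  - by move=> x /IM /=; rewrite in_itv/= ler_norml.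
by rewrite lebesgue_measure_itv/=; case: ifP => _; rewrite ?ltry// -EFinB ltry.
Qed.

End Sampling.

Theorem proposition1 (R : realType) (I : set R) (phi : R -> R -> R[i])
    (intervalI : is_interval I) (boundedI : bounded_set I)
    (kernel_phi : continuous_kernel I phi)
    (sup_phi : (ereal_sup [set cLnorm 1%:E (phi u) | u in I] < +oo)%E)
    (sigma : R) (sigma_gt0 : 0 < sigma)
    (Lambda : set R) (udLambda : uniformly_discrete Lambda) :
  exists B : R, forall f : R -> R[i], PW sigma f ->
    ((\int[lebesgue_measure]_(u in I)
       \esum_(l in Lambda) (cabs (convolution f (phi u) l) ^+ 2)%:E)
     <= B%:E * cLnorm 2%:E f ^+ 2)%E.
Proof.
have [d d0 sepL] := uniformly_discrete_spaced udLambda.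
have [C C0 convC] := convolution_sum_le sigma_gt0 d0.
have [K phiK] : exists K : R, forall u, I u -> (cLnorm 1%:E (phi u) <= K%:E)%E.
  have ub u : I u -> (cLnorm 1%:E (phi u)
    <= ereal_sup [set cLnorm 1%:E (phi u) | u in I])%E.
    by move=> Iu; apply: ereal_sup_ubound; exists u.
  move: sup_phi ub; case: (ereal_sup _) => [K| |]// _ ub; first by exists K.
  (* The supremum is [-oo], as for empty [I]; then any [K] will do. *)
  by exists 0 => u /ub /le_trans; apply; exact: leNye.
have Ifin : (lebesgue_measure I \is a fin_num)%E.
  by rewrite ge0_fin_numE// bounded_set_measure_lty.
exists (C * K ^+ 2 * fine (lebesgue_measure I)) => f fPW.
rewrite EFinM fineK// muleAC.
have N0 : (0 <= cLnorm 2%:E f ^+ 2)%E by exact/expe_ge0/Lnorm_ge0.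
(* The bound is uniform in [u], so integration over [I] only costs the measure of [I]; measurability
   of the sum as a function of [u] is never established. *)
apply: le_integral_cst.
- exact: is_interval_measurable.
- by rewrite mule_ge0// lee_fin mulr_ge0// sqr_ge0.
- by move=> u _; apply: esum_ge0 => l _; rewrite lee_fin sqr_ge0.
(* The sum over [Lambda] is a supremum of sums over finite subsets, each of which inherits the
   spacing [d]. *)
move=> u Iu; apply: ub_ereal_sup => _ [F [finF FL] <-].
rewrite fsbig_finite//=; apply: convC => //.
- exact: continuous_cmeasurable (continuous_kernel_section kernel_phi.1 Iu).
- by apply: phiK.
- exact: finmap.fset_uniq.
- by move=> x y /=; rewrite !in_fset_set// !inE => Fx Fy; apply: sepL;
  exact: FL.
Qed.
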